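(* Let $M$ be a connected oriented surface (isometrically immersed) of a hypersphere $S^{3}$ of $\mathbb{E}^{4}$, whose Laplace map in $\mathbb{E}^4$ is an immersion. Then $M$ has constant mean curvature and conformal $LG$-transformation if and only if $M$ is either a totally umbilical surface or a minimal surface in $S^3$.
   Context: Manifolds and immersions are smooth. Let $x:M\to S^3\subset\mathbb{E}^4$ denote the immersion and $\Delta=-\operatorname{trace}\nabla^2$ the Laplace operator of $M$. The Laplace map is $L:M\to\mathbb{E}^4$, $L(p)=(\Delta x)(p)=-2H(p)$, with $H$ the mean curvature vector of $M$ in $\mathbb{E}^4$. The Gauss map is $G:M\to G(2,2)$, $G(p)=(e_3\wedge e_4)(p)\in\Lambda^2\mathbb{E}^4$, where $e_3,e_4$ is a local oriented orthonormal frame of the normal bundle of $M$ in $\mathbb{E}^4$; the Grassmannian $G(2,2)$ of oriented 2-planes of $\mathbb{E}^4$ carries the metric induced from the Euclidean inner product on $\Lambda^2\mathbb{E}^4$. When $L$ is an immersion, the $LG$-transformation is the (locally defined) map $LG:L(M)\to G(M)$, $LG(L(p))=G(p)$. It is conformal if there is a positive function $f$ on $M$ with $\langle dL(X),dL(Y)\rangle=f^2\langle dG(X),dG(Y)\rangle$ for all tangent vectors $X,Y$ of $M$ at a common point. Constant mean curvature refers to $M$ in $S^3$ (equivalently, to $\|H\|$ in $\mathbb{E}^4$ being constant). Totally umbilical means the shape operator in $S^3$ is a multiple of the identity at each point. *)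

(* Defs.v *)
From HB Require Import structures.
From mathcomp Require Import all_boot all_order all_algebra.
From mathcomp Require Import all_classical all_reals all_analysis.

Set Implicit Arguments.
Unset Strict Implicit.
Unset Printing Implicit Defensive.
Import Order.TTheory GRing.Theory Num.Theory.
Import numFieldNormedType.Exports.
Local Open Scope classical_set_scope.
Local Open Scope ring_scope.

(* C^n on an open set U of R^2.  The conditions (f is differentiable on U and
   every directional derivative with a fixed direction is C^(n-1)) amount to
   the existence and continuity of all partial derivatives of order <= n. *)
Fixpoint Cn_on (R : realType) (V : normedModType R) (n : nat)
    (U : set 'rV[R]_2) (f : 'rV[R]_2 -> V) : Prop :=
  match n with
  | 0 => forall u, U u -> {for u, continuous f}
  | k.+1 => (forall u, U u -> differentiable f u) /\
            (forall v, Cn_on k U (fun u => 'D_v f u))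
  end.

Definition smooth_on (R : realType) (V : normedModType R)
    (U : set 'rV[R]_2) (f : 'rV[R]_2 -> V) : Prop :=
  forall n, Cn_on n U f.

(* A smooth oriented surface (without boundary), given by an oriented smooth
   atlas.  The chart of index a is the homeomorphism coord a from the open set
   dom a onto an open subset of R^2; its inverse is the restriction of the
   total function param a to that subset, and the values of coord a and
   param a elsewhere are irrelevant. *)
Record orientedSurface (R : realType) := OrientedSurface {
  point :> topologicalType;
  chart : Type;
  dom : chart -> set point;
  coord : chart -> point -> 'rV[R]_2;
  param : chart -> 'rV[R]_2 -> point;
  surface_hausdorff : hausdorff_space point;
  surface_second_countable : @second_countable point;
  chart_cover : forall p, exists a, dom a p;
  dom_open : forall a, open (dom a);
  image_open : forall a, open (coord a @` dom a);
  coordK : forall a p, dom a p -> param a (coord a p) = p;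
  coord_continuous : forall a p, dom a p -> {for p, continuous (coord a)};
  param_continuous : forall a u, (coord a @` dom a) u ->
    {for u, continuous (param a)};
  transition_smooth : forall a b,
    smooth_on (coord a @` (dom a `&` dom b)) (coord b \o param a);
  transition_oriented : forall a b p, dom a p -> dom b p ->
    0 < \det ('J (coord b \o param a) (coord a p))
}.

Definition chart_at (R : realType) (M : orientedSurface R) (p : M) : chart M :=
  sval (cid (chart_cover p)).

Definition smooth_map (R : realType) (M : orientedSurface R)
    (V : normedModType R) (f : M -> V) : Prop :=
  forall a : chart M, smooth_on (coord a @` dom a) (f \o param a).

(* df(X), where X is the tangent vector at p with components v in the chart a *)
Definition dmap (R : realType) (M : orientedSurface R) (V : normedModType R)
    (f : M -> V) (a : chart M) (p : M) (v : 'rV[R]_2) : V :=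
  'D_v (f \o param a) (coord a p).

Definition immersion (R : realType) (M : orientedSurface R)
    (V : normedModType R) (f : M -> V) : Prop :=
  smooth_map f /\
  forall (a : chart M) (p : M), dom a p -> injective (dmap f a p).

Definition dot (R : realType) (n : nat) (u v : 'rV[R]_n) : R :=
  \sum_(i < n) u 0 i * v 0 i.

(* Lambda^2 E^4 is identified with the skew-symmetric 4 x 4 matrices, the
   inner product being the one for which the e_i /\ e_j, i < j, are
   orthonormal. *)
Definition wedge (R : realType) (u v : 'rV[R]_4) : 'M[R]_4 :=
  u^T *m v - v^T *m u.

Definition dot2 (R : realType) (A B : 'M[R]_4) : R :=
  \sum_(i < 4) \sum_(j < 4 | (i < j)%N) A i j * B i j.

Section LocalParametrization.
Variables (R : realType).

Definition partial (V : normedModType R) (i : 'I_2) (f : 'rV[R]_2 -> V) :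
    'rV[R]_2 -> V :=
  fun u => 'D_(delta_mx 0 i) f u.

Variable y : 'rV[R]_2 -> 'rV[R]_4.

Definition metric (u : 'rV[R]_2) : 'M[R]_2 :=
  \matrix_(i, j) dot (partial i y u) (partial j y u).

(* Gamma^k_ij of the Levi-Civita connection of the induced metric *)
Definition christoffel (k i j : 'I_2) (u : 'rV[R]_2) : R :=
  2^-1 * \sum_(l < 2) invmx (metric u) k l *
    (partial i (fun w => metric w j l : R^o) u
     + partial j (fun w => metric w i l : R^o) u
     - partial l (fun w => metric w i j : R^o) u).

Definition hessian (V : normedModType R) (f : 'rV[R]_2 -> V) (i j : 'I_2)
    (u : 'rV[R]_2) : V :=
  partial i (partial j f) u - \sum_(k < 2) christoffel k i j u *: partial k f u.

Definition laplacian (V : normedModType R) (f : 'rV[R]_2 -> V)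
    (u : 'rV[R]_2) : V :=
  - \sum_(i < 2) \sum_(j < 2) invmx (metric u) i j *: hessian f i j u.

End LocalParametrization.

Section SurfaceInSphere.
Variables (R : realType) (M : orientedSurface R).
Variables (c : 'rV[R]_4) (r : R) (x : M -> 'rV[R]_4).

Definition in_hypersphere : Prop :=
  forall p, dot (x p - c) (x p - c) = r ^+ 2.

Definition laplace_map (p : M) : 'rV[R]_4 :=
  let y := x \o param (chart_at p) in laplacian y y (coord (chart_at p) p).

(* (e3, e4) is an orthonormal basis of the normal space of M in E^4 at p,
   positively oriented: a positive basis of the tangent plane followed by
   e3, e4 is a positive basis of E^4. *)
Definition oriented_normal_frame (p : M) (e3 e4 : 'rV[R]_4) : Prop :=
  [/\ dot e3 e3 = 1, dot e4 e4 = 1, dot e3 e4 = 0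
    & forall a : chart M, dom a p ->
      let d i := dmap x a p (delta_mx 0 i) in
      [/\ forall i, dot (d i) e3 = 0, forall i, dot (d i) e4 = 0
        & 0 < \det (\matrix_(i < 4) [:: d 0; d 1; e3; e4]`_i)]].

(* e3 /\ e4 does not depend on the oriented normal frame *)
Definition gauss_map (p : M) : 'M[R]_4 :=
  xget 0 [set w | exists e3 e4, oriented_normal_frame p e3 e4 /\
                                w = wedge e3 e4].

Definition conformal_LG : Prop :=
  exists2 f : M -> R, (forall p, 0 < f p) &
    forall (a : chart M) (p : M), dom a p -> forall v w : 'rV[R]_2,
      dot (dmap laplace_map a p v) (dmap laplace_map a p w) =
      f p ^+ 2 * dot2 (dmap gauss_map a p v) (dmap gauss_map a p w).

(* the unit normal of M in the hypersphere with centre c and radius r, whose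
   own unit normal at x p is (x p - c) / r *)
Definition sphere_normal (p : M) : 'rV[R]_4 :=
  xget 0 [set e | oriented_normal_frame p e (r^-1 *: (x p - c))].

(* Second fundamental form of M in the hypersphere: sphere_normal is tangent
   to the hypersphere, so pairing with it gives the same result for the
   connections of the hypersphere and of E^4. *)
Definition second_form (a : chart M) (p : M) : 'M[R]_2 :=
  \matrix_(i, j)
    dot (partial i (partial j (x \o param a)) (coord a p)) (sphere_normal p).

(* Matrix of the shape operator, acting on the row vectors of components in
   the chart a: v *m shape_operator a p are the components of A(X), where
   <A(X), Y> = second_form (X, Y). *)
Definition shape_operator (a : chart M) (p : M) : 'M[R]_2 :=
  second_form a p *m invmx (metric (x \o param a) (coord a p)).

Definition mean_curvature (p : M) : R :=
  2^-1 * \tr (shape_operator (chart_at p) p).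

Definition constant_mean_curvature : Prop :=
  exists h : R, forall p, mean_curvature p = h.

Definition minimal_surface : Prop := forall p, mean_curvature p = 0.

Definition totally_umbilical : Prop :=
  forall (a : chart M) (p : M), dom a p ->
    exists k : R, shape_operator a p = k%:M.

End SurfaceInSphere.

(* Main.v *)
(* Along a chart, let N be the unit normal of M in the hypersphere, A the shape
   operator, alpha the mean curvature and s = 1/r^2.  Gauss and
   Weingarten give L = - 2 alpha N + 2 s (x - c) and dN = - dx o A, hence, when
   alpha is constant,
     <dL X, dL Y> = 4 <(alpha A + s) X, (alpha A + s) Y>,
   while <dG X, dG Y> = <A X, A Y> + s <X, Y> because G = N /\ (x - c)/r.
   If both forms are proportional then 4 (alpha A + s)^2 = f^2 (A^2 + s); with
   A^2 = 2 alpha A - det A, a point where A is not scalar forces alpha = 0 or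
   det A = alpha^2, and the latter makes the self-adjoint A scalar.
   Conversely, alpha = 0 gives A^2 = - det A, so that dG is conformal to dx,
   as dL is; and A = alpha Id gives d alpha = 0 by Codazzi's equation, so that
   alpha is constant on the connected surface M. *)

Require Import Defs.
From mathcomp Require Import all_boot all_order all_algebra.
From mathcomp Require Import all_classical all_reals all_analysis.
From mathcomp Require Import ring lra.

Set Implicit Arguments.
Unset Strict Implicit.
Unset Printing Implicit Defensive.
Import Order.TTheory GRing.Theory Num.Theory.
Import numFieldNormedType.Exports.
Local Open Scope classical_set_scope.
Local Open Scope ring_scope.

(** * Differential calculus *)

(** The obstacle is regularity. The unit normal and the Gauss map are picked point by point with
    [xget], and the Laplace map and the mean curvature are computed in [chart_at p], which may jump
    with [p]; none of them is visibly differentiable. Each is therefore first brought to a form that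
    can be differentiated in an arbitrary chart: the normal is a normalised vector product of the
    rows of the Jacobian and the radial vector, the Gauss map is the wedge of that normal with the
    radial vector, and the Laplace map is a combination of the same two vectors, its coefficient
    being a trace, which conjugation by a transition Jacobian does not change. This makes the normal
    differentiable once. Its second derivatives, needed for Codazzi, come from the umbilic relation
    itself, and the derivative of the mean curvature comes from the smoothness of the Laplace map.
    All induced metrics are handled as matrices [X] of forms [v *m X *m w^T] on row vectors.
    Self-adjointness, in the form [g *m A^T = A *m g], lets the metric be moved to the right and
    cancelled, so that conformality becomes an equation between polynomials in [A]. *)

Lemma differentiable_le_near {R : realType} {V W : normedModType R}
    (f : V -> W) (x : V) (e : R) : differentiable f x -> 0 < e ->
  \forall h \near 0, `|f (h + x) - f x - 'D_h f x| <= e * `|h|.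
Proof.
move=> df e0; have /diff_locallyP [_ /eqaddoP /(_ _ e0)] := df.
apply: filterS => h /=; rewrite deriveE//.
by rewrite -[(_ - _) h]/(f (h + x) - (f x + 'd f x h)) opprD addrA.
Qed.

(** The first-order expansion of [f] is also one of [g]; [diff_unique] then identifies the two
    differentials, which is what [differentiable g x] asks for. *)
Lemma near_eq_differentiable {R : realType} {V W : normedModType R}
    (f g : V -> W) (x : V) :
  {near x, f =1 g} -> differentiable f x -> differentiable g x.
Proof.
move=> fg df; have /diff_locallyP [dfc /eqaddoP dfx] := df.
have fgx := nbhs_singleton fg.
suff H : g \o shift x = cst (g x) + 'd f x +o_ 0 id.
  by apply/diff_locallyP; rewrite (diff_unique dfc H).
apply/eqaddoP => e e0; move: (dfx e e0).
have : \forall h \near 0, f (h + x) = g (h + x).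
  have cv : (h + x) @[h --> (0 : V)] --> x.
    by rewrite -[X in _ --> X]add0r; apply: cvgD;
      [exact: cvg_id|exact: cvg_cst].
  exact: (cv [set y | f y = g y] fg).
apply: filterS2 => h /= fgh.
by rewrite -![(_ - _) h]/(_ - (_ + _)) /= fgh fgx.
Qed.

Lemma is_derive_line {R : realType} {V W : normedModType R}
    (f : V -> W) (v y : V) (s : R) : derivable f (s *: v + y) v ->
  is_derive s 1 (fun h => f (h *: v + y)) ('D_v f (s *: v + y)).
Proof.
rewrite /derivable /derive => H.
have E : (fun h : R => h^-1 *: ((f (h *: v + (s *: v + y))) - f (s *: v + y))) =
  (fun h : R => h^-1 *: (f ((h *: 1 + s) *: v + y) - f (s *: v + y))).
  by apply/funext => h; rewrite [h *: 1]mulr1 scalerDl addrA.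
by split; rewrite /derivable /derive -E.
Qed.

(** A ball contains the segments to its centre, so the mean value theorem can be applied along
    them. *)
Lemma derive0_near_constant {R : realType} {V : normedModType R}
    (f : V -> R) (x : V) :
  (\forall y \near x, forall v, derivable f y v /\ 'D_v f y = 0) ->
  \forall y \near x, f y = f x.
Proof.
move=> /nbhs_ballP[e /= e0 H]; apply/nbhs_ballP; exists e => //= y xy.
have B (s : R) : 0 <= s -> s <= 1 -> ball x e (s *: (y - x) + x).
  move=> s0 s1; rewrite -ball_normE /= opprD addrCA subrr addr0 normrN.
  rewrite normrZ ger0_norm// (le_lt_trans (ler_piMl _ s1))//.
  by move: xy; rewrite -ball_normE /= distrC.
have D (s : R) : 0 <= s -> s <= 1 ->
    is_derive s 1 (fun h => f (h *: (y - x) + x)) 0.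
  move=> s0 s1; have [dv <-] := H _ (B _ s0 s1) (y - x).
  exact: is_derive_line.
have [s||c _] := @MVT R (fun h => f (h *: (y - x) + x)) (fun=> 0) 0 1 ltr01.
- by rewrite in_itv /= => /andP[/ltW s0 /ltW s1]; exact: D.
- apply: derivable_within_continuous => s; rewrite in_itv /= => /andP[s0 s1].
  by case: (D _ s0 s1).
by rewrite scale1r subrK scale0r add0r mul0r => /eqP; rewrite subr_eq0 => /eqP.
Qed.

(* Young's argument: the mean value theorem in the direction [u], followed by
   the differentiability of ['D_u f] at [x]; the difference quotient is
   symmetric in [u] and [v], whence [derive_comm]. *)
Lemma second_difference {R : realType} {V : normedModType R}
    (f : V -> R) (x u v : V) (e : R) : 0 < e ->
  (\forall y \near x, differentiable f y) -> differentiable ('D_u f) x ->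
  \forall t \near 0^'+, `|((f (t *: u + (t *: v + x)) - f (t *: v + x)
     - f (t *: u + x) + f x) / t ^+ 2) - 'D_v ('D_u f) x| <= e.
Proof.
move=> e0 df du.
pose k := `|u| + `|v| + 1.
have k0 : 0 < k by rewrite ltr_wpDl// addr_ge0.
(* Two remainders are estimated below, at points of norm at most [t * k]; this tolerance makes each
   at most [e * t / 2], and the division by [t] leaves [e] for their sum. The summand 1 in [k] keeps
   it positive when [u] and [v] vanish. *)
have ek : 0 < e / (2 * k) by rewrite divr_gt0// mulr_gt0.
have /nbhs_ballP[d /= d0 dP] := differentiable_le_near du ek.
move: df => /nbhs_ballP[d' /= d'0 d'P].
near=> t.
have t0 : 0 < t by near: t; exact: nbhs_right_gt.
have tk w : `|w| <= t * k -> ball 0 d w /\ ball x d' (w + x).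
  have td : t * k < Num.min d d'.
    rewrite -ltr_pdivlMr//; near: t; apply: nbhs_right_lt.
    by rewrite divr_gt0// lt_min d0.
  move=> w1; rewrite -!ball_normE /= sub0r opprD addrCA subrr addr0 normrN.
  by apply/andP; rewrite -lt_min (le_lt_trans w1).
have nle (s b : R) : 0 <= s -> s <= t -> 0 <= b -> b <= t ->
    `|s *: u + b *: v| <= t * k.
  move=> s0 st b0 bt; apply: (le_trans (ler_normD _ _)).
  rewrite !normrZ !ger0_norm// /k !mulrDr mulr1 -[leLHS]addr0.
  by rewrite lerD ?(ltW t0)// lerD// ler_wpM2r.
have dline (s b : R) : 0 <= s -> s <= t -> 0 <= b -> b <= t ->
   is_derive s 1 (fun h => f (h *: u + (b *: v + x)))
     ('D_u f (s *: u + (b *: v + x))).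
  move=> s0 st b0 bt; apply: is_derive_line; apply: diff_derivable; apply: d'P.
  by rewrite addrA; apply: (tk _ _).2; apply: nle.
(* The summand [0 *: v] is kept so that [dline] covers both terms, with [b = t] and [b = 0]. *)
pose phi (h : R) := f (h *: u + (t *: v + x)) - f (h *: u + (0 *: v + x)).
pose dphi (s : R) := 'D_u f (s *: u + (t *: v + x))
  - 'D_u f (s *: u + (0 *: v + x)).
have dphiP (s : R) : 0 <= s -> s <= t -> is_derive s 1 phi (dphi s).
  by move=> s0 st; apply: is_deriveB; apply: dline => //; exact: ltW.
have [s||c] := @MVT R phi dphi 0 t t0.
- by rewrite in_itv /= => /andP[/ltW s0 /ltW s1]; exact: dphiP.
- apply: derivable_within_continuous => s; rewrite in_itv /= => /andP[s0 s1].
  by case: (dphiP _ s0 s1).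
rewrite in_itv /= => /andP[/ltW c0 /ltW ct]; rewrite subr0.
rewrite /phi !scale0r !add0r => phiE.
have -> : f (t *: u + (t *: v + x)) - f (t *: v + x) - f (t *: u + x) + f x =
  dphi c * t by rewrite -phiE; ring.
rewrite expr2 invfM mulrACA mulfV ?gt_eqF// mulrC mul1r.
rewrite /dphi scale0r add0r addrA.
set w := c *: u + t *: v; set z := c *: u.
have wk : `|w| <= t * k by apply: nle => //; exact: ltW.
have zk : `|z| <= t * k.
  by rewrite -[z]addr0 -(scale0r v); apply: nle => //; exact: ltW.
have Dwz : 'D_w ('D_u f) x - 'D_z ('D_u f) x = t * 'D_v ('D_u f) x.
  by rewrite !deriveE// -linearB /w /z addrC addKr linearZ.
have Hw : `|'D_u f (w + x) - 'D_u f x - 'D_w ('D_u f) x| <= e * t / 2.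
  apply: (le_trans (dP _ (tk _ wk).1));
    rewrite (le_trans (ler_wpM2l (ltW ek) wk))//.
  by rewrite le_eqVlt; apply/orP; left; apply/eqP; field; rewrite gt_eqF.
have Hz : `|'D_u f (z + x) - 'D_u f x - 'D_z ('D_u f) x| <= e * t / 2.
  apply: (le_trans (dP _ (tk _ zk).1));
    rewrite (le_trans (ler_wpM2l (ltW ek) zk))//.
  by rewrite le_eqVlt; apply/orP; left; apply/eqP; field; rewrite gt_eqF.
have -> : ('D_u f (w + x) - 'D_u f (z + x)) / t - 'D_v ('D_u f) x =
  (('D_u f (w + x) - 'D_u f x - 'D_w ('D_u f) x) -
   ('D_u f (z + x) - 'D_u f x - 'D_z ('D_u f) x)) / t.
  have -> : 'D_w ('D_u f) x = t * 'D_v ('D_u f) x + 'D_z ('D_u f) x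
    by rewrite -Dwz subrK.
  move: ('D_u f (w + x)) ('D_u f (z + x)) ('D_u f x) ('D_z ('D_u f) x)
    ('D_v ('D_u f) x) => a b m k1 k2.
  by field; rewrite gt_eqF.
rewrite normrM normfV (gtr0_norm t0) ler_pdivrMr//.
apply: (le_trans (ler_normB _ _)); apply: (le_trans (lerD Hw Hz)).
by rewrite -splitr.
Unshelve. all: by end_near. Qed.

Lemma derive_comm {R : realType} {V : normedModType R}
    (f : V -> R) (x u v : V) : (\forall y \near x, differentiable f y) ->
  differentiable ('D_u f) x -> differentiable ('D_v f) x ->
  'D_v ('D_u f) x = 'D_u ('D_v f) x.
Proof.
move=> df du dv; apply/eqP; rewrite -subr_eq0 -normr_le0;
  apply/ler_addgt0Pl => e e0.
rewrite addr0; have e2 : 0 < e / 2 by rewrite divr_gt0.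
have [t [H1 H2]] := filter_ex (filterI
  (second_difference v e2 df du) (second_difference u e2 df dv)).
have E : (f (t *: v + (t *: u + x)) - f (t *: u + x) - f (t *: v + x) + f x) =
  (f (t *: u + (t *: v + x)) - f (t *: v + x) - f (t *: u + x) + f x).
  by rewrite addrCA; ring.
rewrite E distrC in H2; rewrite (splitr e) distrC; apply: le_trans (lerD H2 H1).
by apply: le_trans (ler_normD _ _); rewrite addrA subrK.
Qed.

Lemma differentiable_entry {R : realType} {V : normedModType R} m n
    (f : V -> 'M[R]_(m, n)) x i j :
  differentiable f x -> differentiable (fun z => f z i j) x.
Proof.
move=> df; exact: (@differentiable_comp _ _ _ _ f
  (fun M : 'M[R]_(m, n) => M i j) _ df (differentiable_coord _ i j)).
Qed.

Lemma derive_entry {R : realType} {V : normedModType R} m n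
    (f : V -> 'M[R]_(m, n)) x v i j :
  differentiable f x -> ('D_v f x) i j = 'D_v (fun z => f z i j) x.
Proof. by move=> df; rewrite derive_mx ?mxE//; exact: diff_derivable. Qed.

Lemma derive_comm_mx {R : realType} {V : normedModType R} (m n : nat)
    (f : V -> 'M[R]_(m, n)) (x u v : V) :
  (\forall y \near x, differentiable f y) ->
  differentiable ('D_u f) x -> differentiable ('D_v f) x ->
  'D_v ('D_u f) x = 'D_u ('D_v f) x.
Proof.
move=> df du dv.
have near_entry w i j :
    \forall y \near x, ('D_w f y) i j = 'D_w (fun z => f z i j) y.
  by apply: filterS df => y; exact: derive_entry.
have comm_entry i j :
    'D_v (fun z => ('D_u f z) i j) x = 'D_u (fun z => ('D_v f z) i j) x.
  transitivity ('D_v ('D_u (fun z => f z i j)) x).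
    exact: near_eq_derive (near_entry u i j).
  transitivity ('D_u ('D_v (fun z => f z i j)) x); last first.
    by apply/esym; exact: near_eq_derive (near_entry v i j).
  apply: derive_comm; first by apply: filterS df => y;
    exact: differentiable_entry.
  - exact: near_eq_differentiable (near_entry u i j)
    (differentiable_entry _ _ du).
  - exact: near_eq_differentiable (near_entry v i j)
    (differentiable_entry _ _ dv).
apply/matrixP => i j; transitivity ('D_v (fun z => ('D_u f z) i j) x).
  exact: derive_entry.
by rewrite comm_entry; apply/esym; exact: derive_entry.
Qed.

Lemma differentiable_mx {R : realType} {V : normedModType R} (m n : nat)
    (f : V -> 'M[R]_(m, n)) (x : V) :
  (forall i j, differentiable (fun z => f z i j) x) -> differentiable f x.
Proof.
move=> df.
have -> : f = \sum_(i < m) \sum_(j < n) (fun z => f z i j *: delta_mx i j).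
  apply/funext => z; rewrite fct_sumE [LHS]matrix_sum_delta.
  by apply: eq_bigr => i _; rewrite fct_sumE.
apply: differentiable_sum => i; apply: differentiable_sum => j.
exact: differentiableZl.
Qed.

Lemma derive_comp {R : realType} {V U W : normedModType R}
    (f : V -> U) (g : U -> W) (x v : V) :
  differentiable f x -> differentiable g (f x) ->
  'D_v (g \o f) x = 'D_('D_v f x) g (f x).
Proof.
move=> df dg; have dfg := differentiable_comp df dg.
by rewrite (deriveE v dfg) (diff_comp df dg) /= -(deriveE v df) -(deriveE _ dg).
Qed.

(** * Normal frames in E^4 *)

Section Dot.
Variables (R : realType) (n : nat).
Implicit Types u v w : 'rV[R]_n.

Lemma dotE u v : dot u v = (u *m v^T) 0 0.
Proof. by rewrite /dot !mxE; apply: eq_bigr => i _; rewrite !mxE. Qed.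

Lemma dotC u v : dot u v = dot v u.
Proof. by apply: eq_bigr => i _; rewrite mulrC. Qed.

Lemma dotDl u v w : dot (u + v) w = dot u w + dot v w.
Proof. by rewrite !dotE mulmxDl mxE. Qed.

Lemma dotZl k u w : dot (k *: u) w = k * dot u w.
Proof. by rewrite !dotE -scalemxAl mxE. Qed.

Lemma dotNl u w : dot (- u) w = - dot u w.
Proof. by rewrite !dotE mulNmx mxE. Qed.

Lemma dotDr u v w : dot w (u + v) = dot w u + dot w v.
Proof. by rewrite ![dot w _]dotC dotDl. Qed.

Lemma dotZr k u w : dot w (k *: u) = k * dot w u.
Proof. by rewrite ![dot w _]dotC dotZl. Qed.

Lemma dotNr u w : dot w (- u) = - dot w u.
Proof. by rewrite ![dot w _]dotC dotNl. Qed.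

Lemma dot_ge0 u : 0 <= dot u u.
Proof. by apply: sumr_ge0 => i _; rewrite -expr2 sqr_ge0. Qed.

Lemma dot_eq0 u : dot u u = 0 -> u = 0.
Proof.
move=> /eqP; rewrite psumr_eq0; last by move=> i _; rewrite -expr2 sqr_ge0.
move=> /allP H; apply/rowP => i; rewrite mxE; apply/eqP.
by have := H i (mem_index_enum _); rewrite -expr2 sqrf_eq0.
Qed.

Lemma dot_rowE m k (A : 'M[R]_(m, n)) (B : 'M[R]_(k, n)) i j :
  dot (row i A) (row j B) = (A *m B^T) i j.
Proof. by rewrite /dot mxE; apply: eq_bigr => l _; rewrite !mxE. Qed.

End Dot.

Definition rows2 (R : realType) n (u v : 'rV[R]_n) : 'M[R]_(2, n) :=
  \matrix_(i < 2) [:: u; v]`_i.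

Section Rows2.
Variables (R : realType) (n : nat).
Implicit Types u v w : 'rV[R]_n.

Lemma rows2E (A : 'M[R]_(2, n)) : A = rows2 (row 0 A) (row 1 A).
Proof.
apply/row_matrixP => i; rewrite rowK.
by case: i => [[|[|//]] Hi] /=; congr row; exact: val_inj.
Qed.

Lemma row_rows2 u v (i : 'I_2) : row i (rows2 u v) = if i == 0 then u else v.
Proof. by rewrite rowK; case: i => [[|[|//]] Hi]. Qed.

Lemma mul_rows2_tr m (A : 'M[R]_(m, n)) u v :
  A *m (rows2 u v)^T =
  \matrix_(i < m, j < 2) dot (row i A) (if j == 0 then u else v).
Proof. by apply/matrixP => i j; rewrite -dot_rowE row_rows2 !mxE. Qed.

Lemma mulmx_row_tr_eq0 m (A : 'M[R]_(m, n)) u :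
  A *m u^T = 0 <-> forall i, dot (row i A) u = 0.
Proof.
have E i : (A *m u^T) i 0 = dot (row i A) u.
  by rewrite /dot mxE; apply: eq_bigr => l _; rewrite !mxE.
split=> [Au i|Au]; first by rewrite -E Au mxE.
by apply/matrixP => i j; rewrite ord1 E Au mxE.
Qed.

Lemma mulmx_trC_eq0 m k (A : 'M[R]_(m, n)) (B : 'M[R]_(k, n)) :
  A *m B^T = 0 -> B *m A^T = 0.
Proof. by move=> AB; rewrite -[B *m _]trmxK trmx_mul trmxK AB trmx0. Qed.

Lemma mul_rows2_tr_eq0 m (A : 'M[R]_(m, n)) u v :
  A *m u^T = 0 -> A *m v^T = 0 -> A *m (rows2 u v)^T = 0.
Proof.
move=> /mulmx_row_tr_eq0 Au /mulmx_row_tr_eq0 Av.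
by rewrite mul_rows2_tr; apply/matrixP => i j; rewrite !mxE; case: ifP.
Qed.

Lemma rows2_gram1 u v : dot u u = 1 -> dot v v = 1 -> dot u v = 0 ->
  rows2 u v *m (rows2 u v)^T = 1%:M.
Proof.
move=> uu vv uv; apply/matrixP => i j; rewrite -dot_rowE !row_rows2 !mxE.
by case: i j => [[|[|//]] Hi] [[|[|//]] Hj] //=; rewrite dotC.
Qed.

End Rows2.

Section Frame.
Variable (R : realType).
Implicit Types (Y Z : 'M[R]_(2, 4)).

Lemma det_col_mx_mul (P Q : 'M[R]_2) Y Z :
  \det (col_mx (P *m Y) (Q *m Z) : 'M[R]_4) =
  \det P * \det Q * \det (col_mx Y Z : 'M[R]_4).
Proof.
have -> : (col_mx (P *m Y) (Q *m Z) : 'M[R]_4) =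
    (block_mx P 0 0 Q : 'M[R]_4) *m (col_mx Y Z : 'M[R]_4).
  by rewrite [RHS](mul_block_col P 0 0 Q Y Z) !mul0mx addr0 add0r.
by rewrite det_mulmx; congr (_ * _); exact: (det_ublock P 0 Q).
Qed.

(** The square of the determinant is that of the Gram matrix of the four rows, which is block
    triangular when the rows of [Y] are orthogonal to those of [Z]. *)
Lemma det_gram_col Y Z : Y *m Z^T = 0 ->
  \det (col_mx Y Z : 'M[R]_4) ^+ 2 = \det (Y *m Y^T) * \det (Z *m Z^T).
Proof.
move=> YZ; rewrite expr2 -{2}det_tr -det_mulmx.
have -> : (col_mx Y Z : 'M[R]_4) *m (col_mx Y Z)^T =
    (block_mx (Y *m Y^T) 0 (Z *m Y^T) (Z *m Z^T) : 'M[R]_4).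
  by rewrite [(col_mx Y Z)^T]tr_col_mx [LHS](mul_col_row Y Z Y^T Z^T) YZ.
exact: (det_lblock (Y *m Y^T)).
Qed.

Lemma frame_orthogonal_eq0 m Y Z (W : 'M[R]_(m, 4)) :
  \det (col_mx Y Z : 'M[R]_4) != 0 -> W *m Y^T = 0 -> W *m Z^T = 0 -> W = 0.
Proof.
move=> d0 WY WZ; pose F : 'M[R]_4 := (col_mx Y Z)^T.
have F1 : F \in unitmx by rewrite unitmxE det_tr unitfE.
have -> : W = (W *m F) *m invmx F by rewrite mulmxK.
have -> : W *m F = (row_mx (W *m Y^T) (W *m Z^T) : 'M[R]_(m, 4)).
  by rewrite /F [X in _ *m X]tr_col_mx [LHS](mul_mx_row W Y^T Z^T).
by rewrite WY WZ [row_mx _ _]row_mx0 mul0mx.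
Qed.

Lemma det_frame_neq0 Y Z : \det (Y *m Y^T) != 0 -> Y *m Z^T = 0 ->
  Z *m Z^T = 1%:M -> \det (col_mx Y Z : 'M[R]_4) != 0.
Proof.
by move=> Y0 YZ ZZ; rewrite -sqrf_eq0 det_gram_col// ZZ det1 mulr1.
Qed.

(** [Z' *m Z^T] is the change between two orthonormal bases of the normal plane. It is orthogonal,
    so its determinant squares to 1, and the two positive frames of E^4 exclude the value -1. *)
Lemma normal_frame_rotation Y Z Z' : \det (Y *m Y^T) != 0 ->
  Y *m Z^T = 0 -> Z *m Z^T = 1%:M -> Y *m Z'^T = 0 -> Z' *m Z'^T = 1%:M ->
  0 < \det (col_mx Y Z : 'M[R]_4) -> 0 < \det (col_mx Y Z' : 'M[R]_4) ->
  Z' = Z' *m Z^T *m Z /\ \det (Z' *m Z^T) = 1.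
Proof.
move=> Y0 YZ ZZ YZ' ZZ' dZ dZ'; set Q := Z' *m Z^T.
have d0 := det_frame_neq0 Y0 YZ ZZ.
have E : Z' = Q *m Z.
  apply/eqP; rewrite -subr_eq0; apply/eqP; apply: (frame_orthogonal_eq0 d0).
    by rewrite mulmxBl -mulmxA (mulmx_trC_eq0 YZ)
      (mulmx_trC_eq0 YZ') mulmx0 subr0.
  by rewrite mulmxBl -mulmxA ZZ mulmx1 subrr.
split=> //.
have QQ : Q *m Q^T = 1%:M.
  have -> : Q *m Q^T = (Q *m Z) *m (Q *m Z)^T.
    by rewrite [(Q *m Z)^T]trmx_mul mulmxA -[Q *m Z *m _]mulmxA ZZ mulmx1.
  by rewrite -E.
have Qge0 : 0 <= \det Q.
  move: dZ'; rewrite E -{1}[Y]mul1mx det_col_mx_mul det1 mul1r.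
  by rewrite pmulr_lgt0// => /ltW.
apply/eqP; rewrite -(@eqrXn2 _ 2)// expr1n expr2 -{2}det_tr -det_mulmx QQ.
by rewrite det1.
Qed.

(** The standard area form of the plane. A congruence by [Q] multiplies it by [\det Q], which is how
    a wedge product changes under a change of basis of its plane. *)
Definition skew2 : 'M[R]_2 :=
  \matrix_(i, j) if i == j then 0 else if i == 0 then 1 else -1.

Lemma det_mx2 (A : 'M[R]_2) : \det A = A 0 0 * A 1 1 - A 0 1 * A 1 0.
Proof.
have l0 : lift 0 0 = 1 :> 'I_2 by exact: val_inj.
have l1 : lift 1 0 = 0 :> 'I_2 by exact: val_inj.
rewrite (expand_det_row _ 0) big_ord_recl big_ord1 /cofactor.
rewrite !det_mx11 !mxE l0 l1.
by rewrite /= expr0 expr1 mul1r mulN1r mulrN.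
Qed.

Lemma mxE2 (A B : 'M[R]_2) : A 0 0 = B 0 0 -> A 0 1 = B 0 1 ->
  A 1 0 = B 1 0 -> A 1 1 = B 1 1 -> A = B.
Proof.
move=> H1 H2 H3 H4; apply/matrixP => i j.
have o2 (k : 'I_2) : (k = 0) \/ (k = 1).
  by case: k => [[|[|//]] Hk]; [left|right]; exact: val_inj.
by case: (o2 i) => ->; case: (o2 j) => ->.
Qed.

Lemma mulmx2E m p (A : 'M[R]_(m, 2)) (B : 'M[R]_(2, p)) i j :
  (A *m B) i j = A i 0 * B 0 j + A i 1 * B 1 j.
Proof.
rewrite mxE big_ord_recl big_ord1.
by rewrite (_ : lift 0 0 = 1 :> 'I_2)//; exact: val_inj.
Qed.

Lemma skew2_conj (Q : 'M[R]_2) : Q^T *m skew2 *m Q = \det Q *: skew2.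
Proof.
by rewrite det_mx2; apply: mxE2; rewrite !(mulmx2E, mxE) /=; ring.
Qed.

Lemma wedge_skew (u v : 'rV[R]_4) :
  wedge u v = (rows2 u v)^T *m skew2 *m rows2 u v.
Proof.
apply/matrixP => i j; rewrite !(mulmx2E, mxE) /= !big_ord1 !mxE; ring.
Qed.

Lemma wedge_normal_frame Y (e3 e4 f3 f4 : 'rV[R]_4) :
  let Z := rows2 e3 e4 in let Z' := rows2 f3 f4 in
  \det (Y *m Y^T) != 0 ->
  Y *m Z^T = 0 -> Z *m Z^T = 1%:M -> Y *m Z'^T = 0 -> Z' *m Z'^T = 1%:M ->
  0 < \det (col_mx Y Z : 'M[R]_4) -> 0 < \det (col_mx Y Z' : 'M[R]_4) ->
  wedge f3 f4 = wedge e3 e4.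
Proof.
move=> Z Z' Y0 YZ ZZ YZ' ZZ' dZ dZ'.
have [] := normal_frame_rotation Y0 YZ ZZ YZ' ZZ' dZ dZ'.
move: (Z' *m Z^T) => Q E Q1; rewrite !wedge_skew -/Z -/Z' E trmx_mul.
have -> : Z^T *m Q^T *m skew2 *m (Q *m Z) = Z^T *m (Q^T *m skew2 *m Q) *m Z.
  by rewrite !mulmxA.
by rewrite skew2_conj Q1 scale1r.
Qed.

(** When both frames end with [d], the rotation between them is triangular with determinant
    [dot f e]. This is 1, and unit vectors with inner product 1 coincide. *)
Lemma unit_normal_unique Y (e f d : 'rV[R]_4) :
  let Z := rows2 e d in let Z' := rows2 f d in
  \det (Y *m Y^T) != 0 ->
  Y *m Z^T = 0 -> Z *m Z^T = 1%:M -> Y *m Z'^T = 0 -> Z' *m Z'^T = 1%:M ->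
  0 < \det (col_mx Y Z : 'M[R]_4) -> 0 < \det (col_mx Y Z' : 'M[R]_4) ->
  f = e.
Proof.
move=> Z Z' Y0 YZ ZZ YZ' ZZ' dZ dZ'.
have [_] := normal_frame_rotation Y0 YZ ZZ YZ' ZZ' dZ dZ'.
have ent (a b a' b' : 'rV[R]_4) i j : (rows2 a b *m (rows2 a' b')^T) i j =
    dot (if i == 0 then a else b) (if j == 0 then a' else b').
  by rewrite -dot_rowE !row_rows2.
have := congr1 (fun A : 'M[R]_2 => A 0 0) ZZ.
have := congr1 (fun A : 'M[R]_2 => A 0 1) ZZ'.
have := congr1 (fun A : 'M[R]_2 => A 1 1) ZZ.
have := congr1 (fun A : 'M[R]_2 => A 0 0) ZZ'.
rewrite det_mx2 /Z /Z' !ent !mxE /= => ff dd fd ee.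
rewrite fd dd mul0r subr0 mulr1 => fe.
apply/eqP; rewrite -subr_eq0; apply/eqP/dot_eq0.
by rewrite dotDl !dotDr !dotNl !dotNr ff ee fe [dot e f]dotC fe; ring.
Qed.

(** The ternary vector product of E^4: it represents the linear form sending [v] to the determinant
    with rows [Y], [v], [d]. Being polynomial in the entries, it is differentiable wherever [Y] and
    [d] are. *)
Definition cross Y (d : 'rV[R]_4) : 'rV[R]_4 :=
  \row_j \det (col_mx Y (rows2 (delta_mx 0 j) d) : 'M[R]_4).

Lemma dot_cross Y (d v : 'rV[R]_4) :
  dot (cross Y d) v = \det (col_mx Y (rows2 v d) : 'M[R]_4).
Proof.
pose i0 : 'I_4 := rshift 2 (0 : 'I_2).
(* Cofactors along a row do not involve that row, so [w] may be replaced by 0 and the determinant is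
   seen to be linear in [w]. *)
have cof w j : cofactor (col_mx Y (rows2 w d) : 'M[R]_4) i0 j =
    cofactor (col_mx Y (rows2 0 d) : 'M[R]_4) i0 j.
  congr (_ * \det _); apply/matrixP => i k; rewrite !mxE.
  case: splitP => // l /= il; rewrite !mxE.
  case: l il => [[|[|//]] Hl] //= il.
  by have := neq_bump 2 i; rewrite il addn0 eqxx.
have row0 w j : (col_mx Y (rows2 w d) : 'M[R]_4) i0 j = w 0 j.
  by rewrite [LHS]col_mxEd !mxE.
rewrite (expand_det_row _ i0); apply: eq_bigr => j _.
rewrite row0 cof mxE mulrC (expand_det_row _ i0) (bigD1 j)//= big1 ?addr0.
  by rewrite row0 cof mxE !eqxx mul1r.
by move=> k /negPf kj; rewrite row0 mxE eqxx kj mul0r.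
Qed.

Lemma cross_orthogonal Y (d : 'rV[R]_4) :
  Y *m (cross Y d)^T = 0 /\ dot (cross Y d) d = 0.
Proof.
split.
  apply/mulmx_row_tr_eq0 => i; rewrite dotC dot_cross.
  apply: (@determinant_alternate _ _ _ (lshift 2 i) (rshift 2 (0 : 'I_2))).
    by rewrite eq_lrshift.
  by move=> j; rewrite col_mxEu col_mxEd !mxE.
rewrite dot_cross.
apply: (@determinant_alternate _ _ _ (rshift 2 (0 : 'I_2))
  (rshift 2 (1 : 'I_2))).
  by rewrite eq_rshift.
by move=> j; rewrite !col_mxEd !mxE.
Qed.

(** Three rows in E^4 leave a nonzero vector [v] orthogonal to [Y] and [d]. The determinant with
    rows [Y], [v], [d] is nonzero by [det_gram_col], yet it is the product of [cross Y d] with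
    [v]. *)
Lemma cross_neq0 Y (d : 'rV[R]_4) : \det (Y *m Y^T) != 0 ->
  Y *m d^T = 0 -> dot d d = 1 -> cross Y d != 0.
Proof.
move=> Y0 Yd dd.
pose K := col_mx Y d.
pose v := nz_row (kermx K^T).
have v0 : v != 0.
  rewrite nz_row_eq0 -mxrank_eq0 mxrank_ker -lt0n subn_gt0.
  by apply: leq_ltn_trans (rank_leq_col _) _.
have : v *m K^T = 0 by apply/sub_kermxP; exact: nz_row_sub.
rewrite tr_col_mx mul_mx_row => /eqP.
rewrite -row_mx0 => /eqP /eq_row_mx[vY vd].
have Yv := mulmx_trC_eq0 vY.
have {}vd : dot v d = 0 by rewrite dotE vd mxE.
have vv : dot v v != 0 by apply: contraNneq v0 => /dot_eq0 ->.
apply: contraTneq (isT) => c0.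
have := det_gram_col (mul_rows2_tr_eq0 Yv Yd).
rewrite -dot_cross c0 dotE mul0mx mxE expr2 mul0r => /esym/eqP.
rewrite mulf_eq0 (negPf Y0) /= det_mx2 -!dot_rowE !row_rows2 /= vd dd mul0r.
by rewrite subr0 mulr1 (negPf vv).
Qed.

Definition unit_normal Y (d : 'rV[R]_4) : 'rV[R]_4 :=
  (Num.sqrt (dot (cross Y d) (cross Y d)))^-1 *: cross Y d.

Lemma unit_normalP Y (d : 'rV[R]_4) : \det (Y *m Y^T) != 0 ->
  Y *m d^T = 0 -> dot d d = 1 ->
  let n := unit_normal Y d in
  [/\ dot n n = 1, dot n d = 0, Y *m n^T = 0 &
      0 < \det (col_mx Y (rows2 n d) : 'M[R]_4)].
Proof.
move=> Y0 Yd dd n; have [Yc cd] := cross_orthogonal Y d.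
have c0 := cross_neq0 Y0 Yd dd.
have cc : 0 < dot (cross Y d) (cross Y d).
  rewrite lt_neqAle dot_ge0 andbT eq_sym.
  by apply: contraNneq c0 => /dot_eq0 ->.
have s0 : 0 < Num.sqrt (dot (cross Y d) (cross Y d)) by rewrite sqrtr_gt0.
have ss := sqr_sqrtr (ltW cc).
split.
- rewrite dotZl dotZr -{3}ss; field; exact: lt0r_neq0.
- by rewrite dotZl cd mulr0.
- by rewrite linearZ /= -scalemxAr Yc scaler0.
- by rewrite -dot_cross dotZr mulr_gt0// invr_gt0.
Qed.

Lemma dot2_wedge (a b c d : 'rV[R]_4) :
  dot2 (wedge a b) (wedge c d) = dot a c * dot b d - dot a d * dot b c.
Proof.
rewrite /dot2 /dot /wedge.
do ! rewrite !big_mkcond !big_ord_recl !big_ord0 /=.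
rewrite !mxE !big_ord1 !mxE; ring.
Qed.

Lemma dot2D (a b a' b' : 'M[R]_4) :
  dot2 (a + b) (a' + b') = dot2 a a' + dot2 a b' + dot2 b a' + dot2 b b'.
Proof.
rewrite /dot2 -!big_split; apply: eq_bigr => i _ /=.
by rewrite -!big_split; apply: eq_bigr => j _ /=; rewrite !mxE; ring.
Qed.

(* The left factors have the form of a derivative of [m /\ e]. *)
Lemma dot2_wedge_variation (m e a a' b b' : 'rV[R]_4) :
  dot m m = 1 -> dot e e = 1 -> dot m e = 0 ->
  dot a m = 0 -> dot a' m = 0 -> dot a e = 0 -> dot b m = 0 ->
  dot2 (wedge a e + wedge m b) (wedge a' e + wedge m b') =
  dot a a' + dot b b'.
Proof.
move=> mm ee me am am' ae bm.
rewrite dot2D !dot2_wedge (dotC e m) (dotC m a') mm ee me am am' ae bm.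
by ring.
Qed.

End Frame.

(** * Derivatives of matrix-valued maps *)

Section MatrixDerivatives.
Variables (R : realType) (V : normedModType R).

Lemma differentiable_mulmx m n k
    (f : V -> 'M[R]_(m, n)) (g : V -> 'M[R]_(n, k)) x :
  differentiable f x -> differentiable g x ->
  differentiable (fun z => f z *m g z) x.
Proof.
move=> df dg; apply: differentiable_mx => i j.
have -> : (fun z => (f z *m g z) i j) =
    \sum_(l < n) ((fun z => f z i l) * (fun z => g z l j)).
  by apply/funext => z; rewrite mxE fct_sumE.
by apply: differentiable_sum => l; apply: differentiableM;
  exact: differentiable_entry.
Qed.

Lemma derive_mulmx m n k (f : V -> 'M[R]_(m, n)) (g : V -> 'M[R]_(n, k)) x v :
  differentiable f x -> differentiable g x ->
  'D_v (fun z => f z *m g z) x = 'D_v f x *m g x + f x *m 'D_v g x.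
Proof.
move=> df dg; apply/matrixP => i j.
rewrite derive_entry; last exact: differentiable_mulmx.
have -> : (fun z => (f z *m g z) i j) =
    \sum_(l < n) ((fun z => f z i l) * (fun z => g z l j)).
  by apply/funext => z; rewrite mxE fct_sumE.
have dfl l : derivable (fun z => f z i l) x v.
  by apply: diff_derivable; exact: differentiable_entry.
have dgl l : derivable (fun z => g z l j) x v.
  by apply: diff_derivable; exact: differentiable_entry.
rewrite derive_sum; last by move=> l; exact: derivableM.
rewrite !mxE -big_split; apply: eq_bigr => l _ /=.
rewrite (derive_entry v i l df) (derive_entry v l j dg).
rewrite (deriveM (dfl l) (dgl l)).
by rewrite addrC; congr (_ + _); exact: mulrC.
Qed.

Lemma differentiable_trmx m n (f : V -> 'M[R]_(m, n)) x :
  differentiable f x -> differentiable (fun z => (f z)^T) x.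
Proof.
move=> df; apply: differentiable_mx => i j.
under [fun _ => _]eq_fun do rewrite mxE.
exact: differentiable_entry.
Qed.

Lemma derive_trmx m n (f : V -> 'M[R]_(m, n)) x v :
  differentiable f x -> 'D_v (fun z => (f z)^T) x = ('D_v f x)^T.
Proof.
move=> df; apply/matrixP => i j.
rewrite derive_entry ?mxE; last exact: differentiable_trmx.
by under [fun _ => _]eq_fun do rewrite mxE; rewrite derive_entry.
Qed.

Lemma differentiable_dot n (f g : V -> 'rV[R]_n) x :
  differentiable f x -> differentiable g x ->
  differentiable (fun z => dot (f z) (g z)) x.
Proof.
move=> df dg; under [fun _ => _]eq_fun do rewrite dotE.
by apply: differentiable_entry; apply: differentiable_mulmx => //;
  exact: differentiable_trmx.
Qed.

Lemma derive_dot n (f g : V -> 'rV[R]_n) x v :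
  differentiable f x -> differentiable g x ->
  'D_v (fun z => dot (f z) (g z)) x =
  dot ('D_v f x) (g x) + dot (f x) ('D_v g x).
Proof.
move=> df dg; under [fun _ => _]eq_fun do rewrite dotE.
have dg' := differentiable_trmx dg.
rewrite -derive_entry; last exact: differentiable_mulmx.
by rewrite derive_mulmx// derive_trmx// mxE !dotE.
Qed.

Lemma differentiable_prod (I : Type) (r : seq I) (F : I -> V -> R) x :
  (forall i, differentiable (F i) x) ->
  differentiable (fun z => \prod_(i <- r) F i z) x.
Proof.
move=> dF; elim: r => [|i r IH].
  by under [fun _ => _]eq_fun do rewrite big_nil; exact: differentiable_cst.
under [fun _ => _]eq_fun do rewrite big_cons.
exact: (differentiableM (dF i) IH).
Qed.

Lemma differentiable_det n (f : V -> 'M[R]_n) x :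
  differentiable f x -> differentiable (fun z => \det (f z)) x.
Proof.
move=> df; rewrite /determinant.
elim: (index_enum _) => [|s r IH].
  by under [fun _ => _]eq_fun do rewrite big_nil; exact: differentiable_cst.
under [fun _ => _]eq_fun do rewrite big_cons.
apply: differentiableD IH; apply: (differentiableM (differentiable_cst _ _)).
by apply: differentiable_prod => i; exact: differentiable_entry.
Qed.

Lemma differentiable_col_mx m n k
    (f : V -> 'M[R]_(m, k)) (g : V -> 'M[R]_(n, k)) x :
  differentiable f x -> differentiable g x ->
  differentiable (fun z => col_mx (f z) (g z)) x.
Proof.
move=> df dg; apply: differentiable_mx => i j.
under [fun _ => _]eq_fun do rewrite mxE.
by case: fintype.split => l; exact: differentiable_entry.
Qed.

Lemma differentiable_rows2 n (f g : V -> 'rV[R]_n) x :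
  differentiable f x -> differentiable g x ->
  differentiable (fun z => rows2 (f z) (g z)) x.
Proof.
move=> df dg; apply: differentiable_mx => i j.
under [fun _ => _]eq_fun do rewrite mxE.
by case: i => [[|[|//]] Hi] /=; exact: differentiable_entry.
Qed.

Lemma differentiable_sqrt (f : V -> R) x :
  differentiable f x -> 0 < f x -> differentiable (fun z => Num.sqrt (f z)) x.
Proof.
move=> df f0; apply: (@differentiable_comp _ _ _ _ f Num.sqrt) => //.
by apply/derivable1_diffP; have [] := is_derive1_sqrt f0.
Qed.

Lemma differentiable_scale n (k : V -> R) (f : V -> 'rV[R]_n) x :
  differentiable k x -> differentiable f x ->
  differentiable (fun z => k z *: f z) x.
Proof.
move=> dk df; apply: differentiable_mx => i j.
under [fun _ => _]eq_fun do rewrite mxE.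
by apply: differentiableM => //; exact: differentiable_entry.
Qed.

Lemma derive_scale n (k : V -> R) (f : V -> 'rV[R]_n) x v :
  differentiable k x -> differentiable f x ->
  'D_v (fun z => k z *: f z) x = 'D_v k x *: f x + k x *: 'D_v f x.
Proof.
move=> dk df; apply/matrixP => i j.
rewrite derive_entry; last exact: differentiable_scale.
under [fun _ => _]eq_fun do rewrite mxE.
rewrite deriveM; last 2 first.
- exact: diff_derivable.
- by apply: diff_derivable; exact: differentiable_entry.
by rewrite !mxE (derive_entry v i j df) addrC; congr (_ + _); exact: mulrC.
Qed.

Lemma differentiable_unit_normal (Y : V -> 'M[R]_(2, 4)) (d : V -> 'rV[R]_4) x :
  differentiable Y x -> differentiable d x -> cross (Y x) (d x) != 0 ->
  differentiable (fun z => unit_normal (Y z) (d z)) x.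
Proof.
move=> dY dd c0.
have dc : differentiable (fun z => cross (Y z) (d z)) x.
  apply: differentiable_mx => i j; under [fun _ => _]eq_fun do rewrite mxE.
  apply: differentiable_det; apply: (differentiable_col_mx dY).
  by apply: differentiable_rows2 dd; exact: differentiable_cst.
have cc : 0 < dot (cross (Y x) (d x)) (cross (Y x) (d x)).
  rewrite lt_neqAle dot_ge0 andbT eq_sym.
  by apply: contraNneq c0 => /dot_eq0 ->.
apply: differentiable_scale => //; apply: differentiableV.
  by apply: differentiable_sqrt => //; exact: differentiable_dot.
by rewrite gt_eqF// sqrtr_gt0.
Qed.

End MatrixDerivatives.

Lemma differentiable_jacobian_of_rows (R : realType)
  (y : 'rV[R]_2 -> 'rV[R]_4) x :
  (\forall z \near x, differentiable y z) ->
  (forall i, differentiable ('D_(delta_mx 0 i) y) x) ->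
  differentiable (jacobian y) x.
Proof.
move=> dy ddy; apply: differentiable_mx => i j.
apply: (@near_eq_differentiable _ _ _ (fun z => ('D_(delta_mx 0 i) y z) 0 j)).
  apply: filterS dy => z dz; rewrite deriveEjacobian//.
  by rewrite -rowE mxE.
exact: differentiable_entry.
Qed.

(** * Immersions of a plane domain into a hypersphere *)

(** The source of the structure equations: the relations of length and orthogonality that hold
    throughout the open set [U] are differentiated with it. *)
Lemma derive_constant_on (R : realType) (V W : normedModType R) (U : set V)
    (f : V -> W) (k : W) (u v : V) : open U -> U u ->
  (forall z, U z -> f z = k) -> 'D_v f u = 0.
Proof.
move=> oU Uu fk; rewrite -(derive_cst k u v); apply: near_eq_derive.
by apply: filterS (open_nbhs_nbhs (conj oU Uu)) => z; exact: fk.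
Qed.

Lemma row_jacobian (R : realType) n m (f : 'rV[R]_n.+1 -> 'rV[R]_m.+1) u i :
  differentiable f u -> row i (jacobian f u) = 'D_(delta_mx 0 i) f u.
Proof. by move=> df; rewrite deriveEjacobian// rowE. Qed.

Section ImmersionInSphere.
Variables (R : realType) (U : set 'rV[R]_2) (y : 'rV[R]_2 -> 'rV[R]_4).
Variables (c : 'rV[R]_4) (r : R) (n : 'rV[R]_2 -> 'rV[R]_4).
Hypotheses (oU : open U) (r_gt0 : 0 < r).
Hypothesis dy : forall z, U z -> differentiable y z.
Hypothesis ddy : forall z i, U z -> differentiable (partial i y) z.
Hypothesis y_inj : forall z, U z -> injective (fun v => 'D_v y z).
Hypothesis y_sphere : forall z, U z -> dot (y z - c) (y z - c) = r ^+ 2.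
Hypothesis dn : forall z, U z -> differentiable n z.
Hypothesis nn : forall z, U z -> dot (n z) (n z) = 1.
Hypothesis nE : forall z, U z -> dot (n z) (y z - c) = 0.
Hypothesis yn : forall z i, U z -> dot (partial i y z) (n z) = 0.

Let g z : 'M[R]_2 := metric y z.
Let h z : 'M[R]_2 := \matrix_(i, j) dot (partial i (partial j y) z) (n z).

Lemma metricE z : U z -> g z = jacobian y z *m (jacobian y z)^T.
Proof.
move=> Uz; apply/matrixP => i j; rewrite -dot_rowE !row_jacobian ?mxE//;
  exact: dy.
Qed.

(** If [v *m g z = 0], then the derivative of [y] along [v] has length 0, and injectivity gives
    [v = 0]. *)
Lemma metric_unit z : U z -> g z \in unitmx.
Proof.
move=> Uz; rewrite -row_free_unit; apply/row_freeP.
suff : kermx (g z) = 0.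
  move=> /eqP; rewrite kermx_eq0 => /row_freeP[B HB]; by exists B.
apply/row_matrixP => i; rewrite row0; apply: (y_inj Uz) => /=.
have : row i (kermx (g z)) *m g z = 0 by apply/sub_kermxP; exact: row_sub.
move: (row i _) => v; rewrite (metricE Uz) => vg.
rewrite !(deriveEjacobian _ (dy Uz)) mul0mx; apply: dot_eq0.
by rewrite dotE trmx_mul mulmxA -(mulmxA v) vg mul0mx mxE.
Qed.

Lemma metric_posdef z (v : 'rV[R]_2) : U z -> v != 0 ->
  0 < (v *m g z *m v^T) 0 0.
Proof.
move=> Uz v0; have -> : (v *m g z *m v^T) 0 0 =
    dot (v *m jacobian y z) (v *m jacobian y z).
  by rewrite dotE trmx_mul (metricE Uz) !mulmxA.
rewrite lt_neqAle dot_ge0 andbT eq_sym; apply: contra_neq v0 => /dot_eq0 vJ.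
by apply: (y_inj Uz); rewrite !(deriveEjacobian _ (dy Uz)) vJ mul0mx.
Qed.

Lemma differentiable_sphere_position z : U z ->
  differentiable (fun w => y w - c) z.
Proof. by move=> Uz; apply: differentiableB;
  [exact: dy|exact: differentiable_cst]. Qed.

Lemma derive_dot_position (f : 'rV[R]_2 -> 'rV[R]_4) z v : U z ->
  differentiable f z ->
  'D_v (fun w => dot (f w) (y w - c)) z =
  dot ('D_v f z) (y z - c) + dot (f z) ('D_v y z).
Proof.
move=> Uz df; rewrite (derive_dot v df (differentiable_sphere_position Uz)).
congr (_ + dot _ _); rewrite deriveB ?derive_cst ?subr0//.
by apply: diff_derivable; exact: dy.
Qed.

Lemma position_normal z v : U z -> dot ('D_v y z) (y z - c) = 0.
Proof.
move=> Uz; have := derive_constant_on v oU Uz y_sphere.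
have dyc := differentiable_sphere_position Uz.
rewrite (derive_dot_position v Uz dyc).
have -> : 'D_v (fun w => y w - c) z = 'D_v y z.
  rewrite deriveB ?derive_cst ?subr0//.
  by apply: diff_derivable; exact: dy.
by rewrite [dot (y z - c) _]dotC => /eqP; rewrite -mulr2n mulrn_eq0 /= => /eqP.
Qed.

Lemma partial_comm z i j : U z ->
  partial i (partial j y) z = partial j (partial i y) z.
Proof.
move=> Uz; apply: derive_comm_mx; [|exact: ddy|exact: ddy].
by apply: filterS (open_nbhs_nbhs (conj oU Uz)) => w; exact: dy.
Qed.

Lemma second_form_sym z : U z -> (h z)^T = h z.
Proof.
move=> Uz.
have hE i j : h z i j = dot (partial i (partial j y) z) (n z) by rewrite mxE.
apply/matrixP => i j; rewrite [LHS]mxE !hE.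
exact: (f_equal (fun w : 'rV[R]_4 => dot w (n z)) (partial_comm j i Uz)).
Qed.

Lemma metric_sym z : (g z)^T = g z.
Proof. by apply/matrixP => i j; rewrite [LHS]mxE [LHS]mxE [RHS]mxE;
  exact: dotC. Qed.

Lemma dot_derive_normal z i j : U z ->
  dot ('D_(delta_mx 0 i) n z) (partial j y z) = - h z i j.
Proof.
move=> Uz; have yjn w : U w -> dot (n w) (partial j y w) = 0.
  by move=> Uw; rewrite dotC yn.
have := etrans (esym (derive_dot (delta_mx 0 i) (dn Uz) (ddy j Uz)))
  (derive_constant_on (delta_mx 0 i) oU Uz yjn).
by rewrite mxE [dot (n z) _]dotC => /eqP; rewrite addr_eq0 => /eqP.
Qed.

Lemma dot_second_derive_position z i j : U z ->
  dot (partial i (partial j y) z) (y z - c) = - g z i j.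
Proof.
move=> Uz; have yjn w : U w -> dot (partial j y w) (y w - c) = 0.
  by move=> Uw; exact: position_normal.
have := etrans (esym (derive_dot_position (delta_mx 0 i) Uz (ddy j Uz)))
  (derive_constant_on (delta_mx 0 i) oU Uz yjn).
rewrite mxE => /eqP; rewrite addr_eq0 => /eqP ->.
exact: (f_equal -%R (dotC _ _)).
Qed.

Let e4 z : 'rV[R]_4 := r^-1 *: (y z - c).

Lemma dot_e4 z : U z -> dot (e4 z) (e4 z) = 1.
Proof.
by move=> Uz; rewrite dotZl dotZr y_sphere//; field; exact: lt0r_neq0.
Qed.

Lemma normal_frame_det z : U z ->
  \det (col_mx (jacobian y z) (rows2 (n z) (e4 z)) : 'M[R]_4) != 0.
Proof.
move=> Uz; apply: det_frame_neq0.
- by rewrite -metricE// -unitfE -unitmxE metric_unit.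
- apply: mul_rows2_tr_eq0; apply/mulmx_row_tr_eq0 => i; rewrite row_jacobian//;
    try exact: dy.
    exact: yn.
  by rewrite dotZr position_normal// mulr0.
- by apply: rows2_gram1; rewrite ?nn ?dot_e4// dotZr nE// mulr0.
Qed.

(** The Weingarten and Gauss formulas are both proved by testing the difference of their sides
    against this frame. *)
Lemma eq0_by_frame z (w : 'rV[R]_4) : U z ->
  (forall i, dot w (partial i y z) = 0) -> dot w (n z) = 0 ->
  dot w (y z - c) = 0 -> w = 0.
Proof.
move=> Uz wy wn wE; apply: (frame_orthogonal_eq0 (normal_frame_det Uz)).
  apply: mulmx_trC_eq0; apply/mulmx_row_tr_eq0 => i.
  rewrite row_jacobian; last exact: dy.
  by rewrite dotC; exact: wy.
apply: mul_rows2_tr_eq0; apply/mulmx_row_tr_eq0 => i; rewrite row_id//.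
by rewrite dotZr wE mulr0.
Qed.

(** Against the tangent vectors this is [dot_derive_normal]; against [n] and [y - c] both sides
    vanish, as one sees by differentiating [nn] and [nE]. *)
Lemma weingarten z : U z ->
  jacobian n z = - (h z *m invmx (g z)) *m jacobian y z.
Proof.
move=> Uz; apply/eqP; rewrite mulNmx -addr_eq0; apply/eqP/row_matrixP => i.
rewrite row0 linearD /= row_mul row_jacobian; last exact: dn.
have Jy : forall k, row k (jacobian y z) = partial k y z.
  by move=> k; rewrite row_jacobian//; exact: dy.
apply: (eq0_by_frame Uz) => [j||]; rewrite dotDl.
- rewrite (dot_derive_normal i j Uz)
  -row_mul -Jy dot_rowE -mulmxA -(metricE Uz).
  by rewrite (mulmxKV (metric_unit Uz)) addNr.
- have := derive_constant_on (delta_mx 0 i) oU Uz nn.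
  rewrite (derive_dot _ (dn Uz) (dn Uz)).
  rewrite [dot (n z) _]dotC => /eqP; rewrite -mulr2n mulrn_eq0 /= => /eqP ->.
  rewrite add0r dotE -mulmxA (_ : _ *m (n z)^T = 0);
    first by rewrite mulmx0 mxE.
  by apply/mulmx_row_tr_eq0 => k; rewrite Jy (yn k Uz).
- have := etrans (esym (derive_dot_position (delta_mx 0 i) Uz (dn Uz)))
    (derive_constant_on (delta_mx 0 i) oU Uz nE).
  rewrite (etrans (dotC _ _) (yn i Uz)) addr0 => ->.
  rewrite add0r dotE -mulmxA (_ : _ *m (y z - c)^T = 0);
    first by rewrite mulmx0 mxE.
  by apply/mulmx_row_tr_eq0 => k; rewrite Jy; exact: position_normal.
Qed.

Lemma partial_metric z l i j : U z ->
  partial l (fun w => metric y w i j : R^o) z =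
  dot (partial l (partial i y) z) (partial j y z) +
  dot (partial i y z) (partial l (partial j y) z).
Proof.
move=> Uz.
have -> : (fun w => metric y w i j : R^o) =
    (fun w => dot (partial i y w) (partial j y w)).
  by apply/funext => w; rewrite mxE.
by apply: derive_dot; exact: ddy.
Qed.

(** Lowering the index cancels the inverse metric. Of the six products in the derivatives of the
    metric, four cancel in pairs because second derivatives of [y] commute; the other two are equal,
    which absorbs the factor 1/2. *)
Lemma christoffel_lower z i j l : U z ->
  \sum_(k < 2) christoffel y k i j z * g z k l =
  dot (partial i (partial j y) z) (partial l y z).
Proof.
move=> Uz.
pose S := (\row_l (2^-1 * (partial i (fun w => metric y w j l : R^o) z
     + partial j (fun w => metric y w i l : R^o) z
     - partial l (fun w => metric y w i j : R^o) z))) : 'rV[R]_2.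
have chr k : christoffel y k i j z = (S *m invmx (g z)) 0 k.
  rewrite mxE /christoffel mulr_sumr; apply: eq_bigr => m _.
  rewrite /S mxE -/(g z) mulrCA mulrC; congr (_ * _).
  by rewrite -[in LHS](metric_sym z) -trmx_inv mxE.
under eq_bigr do rewrite chr.
have <- : (S *m invmx (g z) *m g z) 0 l =
    \sum_(k < 2) (S *m invmx (g z)) 0 k * g z k l by rewrite mxE.
rewrite (mulmxKV (metric_unit Uz)).
rewrite /S mxE (partial_metric i j l Uz) (partial_metric j i l Uz).
rewrite (partial_metric l i j Uz).
have koszul (D2 : 'I_2 -> 'I_2 -> 'rV[R]_4) (d : 'I_2 -> 'rV[R]_4) :
    (forall i j, D2 i j = D2 j i) ->
    2^-1 * (dot (D2 i j) (d l) + dot (d j) (D2 i l) +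
      (dot (D2 j i) (d l) + dot (d i) (D2 j l)) -
      (dot (D2 l i) (d j) + dot (d i) (D2 l j))) = dot (D2 i j) (d l).
  by move=> D2C; rewrite (D2C j i) (D2C l i) (D2C l j) (dotC (d j)); field.
exact: (koszul (fun i j => partial i (partial j y) z) (fun i => partial i y z)
  (fun i j => partial_comm i j Uz)).
Qed.

(** The Christoffel terms remove the tangential part of the second derivative. The radial
    coefficient is [- g z i j], from [dot_second_derive_position], divided by the squared length
    [r ^+ 2] of [y - c]. *)
Lemma gauss_formula z i j : U z ->
  hessian y y i j z = h z i j *: n z - (r ^- 2 * g z i j) *: (y z - c).
Proof.
move=> Uz; apply/eqP; rewrite -subr_eq0; apply/eqP.
have dsum (w : 'rV[R]_4) :
    dot (\sum_(k < 2) christoffel y k i j z *: partial k y z) w =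
    \sum_(k < 2) christoffel y k i j z * dot (partial k y z) w.
  rewrite dotE mulmx_suml summxE; apply: eq_bigr => k _.
  by rewrite -scalemxAl mxE dotE.
have eq0 : partial i (partial j y) z -
    \sum_(k < 2) christoffel y k i j z *: partial k y z -
    (h z i j *: n z - (r ^- 2 * g z i j) *: (y z - c)) = 0 :> 'rV[R]_4;
      last exact: eq0.
have expand (u s m e t : 'rV[R]_4) a b : dot (u - s - (a *: m - b *: e)) t =
    dot u t - dot s t - (a * dot m t - b * dot e t).
  by rewrite !(dotDl, dotNl, dotZl).
apply: (eq0_by_frame Uz) => [l||]; rewrite expand dsum.
- rewrite (etrans (dotC _ _) (yn l Uz)).
  rewrite (etrans (dotC _ _) (position_normal (delta_mx 0 l) Uz)).
  rewrite !mulr0 subr0 subr0 -(christoffel_lower i j l Uz).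
  apply/eqP; rewrite subr_eq0; apply/eqP/eq_bigr => k _.
  by rewrite [in LHS]mxE.
- rewrite (nn Uz) mulr1 (etrans (dotC _ _) (nE Uz)) mulr0 subr0.
  rewrite big1; last by move=> k _; rewrite (yn k Uz) mulr0.
  by rewrite subr0 [h z i j]mxE subrr.
- rewrite (dot_second_derive_position i j Uz) (nE Uz) (y_sphere Uz).
  rewrite big1; last by move=> k _; rewrite (position_normal _ Uz) mulr0.
  by field; exact: lt0r_neq0.
Qed.

(** The Gauss formula is contracted with the inverse metric; the factor 2 of the radial term is the
    trace of the 2 x 2 identity. *)
Lemma laplacian_position z : U z ->
  laplacian y y z =
  - \tr (h z *m invmx (g z)) *: n z + (2 * r ^- 2) *: (y z - c).
Proof.
move=> Uz; rewrite /laplacian.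
have gsym k l : invmx (g z) k l = invmx (g z) l k.
  by rewrite -[in LHS](metric_sym z) -trmx_inv mxE.
have -> : \sum_(i < 2) \sum_(j < 2)
    invmx (metric y z) i j *: hessian y y i j z =
    \sum_(i < 2) \sum_(j < 2) (invmx (g z) i j * h z i j) *: n z -
    \sum_(i < 2) \sum_(j < 2) (r ^- 2 * (invmx (g z) i j * g z i j))
      *: (y z - c).
  rewrite -sumrB; apply: eq_bigr => i _; rewrite -sumrB; apply: eq_bigr => j _.
  by rewrite (gauss_formula i j Uz) scalerBr !scalerA mulrCA.
under eq_bigr do rewrite -scaler_suml.
under [X in _ - X]eq_bigr do rewrite -scaler_suml -mulr_sumr.
rewrite -!scaler_suml -mulr_sumr.
have -> : \sum_(i < 2) \sum_(j < 2) invmx (g z) i j * h z i j =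
    \tr (h z *m invmx (g z)).
  rewrite /mxtrace exchange_big; apply: eq_bigr => i _; rewrite mxE.
  by apply: eq_bigr => j _; rewrite mulrC -[in LHS](second_form_sym Uz) mxE.
have -> : \sum_(i < 2) \sum_(j < 2) invmx (g z) i j * g z i j = 2.
  transitivity (\tr (invmx (g z) *m g z)).
    rewrite /mxtrace; apply: eq_bigr => i _; rewrite mxE.
    apply: eq_bigr => j _; congr (_ * _).
    by rewrite -[in LHS](metric_sym z) mxE.
  by rewrite mulVmx ?metric_unit// mxtrace1.
by rewrite opprB addrC scaleNr mulrC.
Qed.

(** * Forms induced by the Laplace and Gauss maps in a chart *)

Let s := r ^- 2.

Lemma derive_normal z v : U z ->
  'D_v n z = - (v *m (h z *m invmx (g z)) *m jacobian y z).
Proof.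
move=> Uz; rewrite (deriveEjacobian v (dn Uz)) (weingarten Uz) mulNmx mulmxN.
by rewrite mulmxA.
Qed.

Lemma dot_tangent z (v w : 'rV[R]_2) (P Q : 'M[R]_2) : U z ->
  dot (v *m P *m jacobian y z) (w *m Q *m jacobian y z) =
  (v *m (P *m g z *m Q^T) *m w^T) 0 0.
Proof. by move=> Uz; rewrite dotE !trmx_mul (metricE Uz) !mulmxA. Qed.

(** Since [H] is a constant, no derivative of the mean curvature enters: by Weingarten the
    differential of [L] sends [t] to the tangent vector with components [t *m (2 *: B)], and 4 is
    the square of that 2. *)
Lemma laplace_map_pullback z v w (H : R) : U z ->
  let A := h z *m invmx (g z) in let B := H *: A + s%:M in
  let L u := - (2 * H) *: n u + (2 * s) *: (y u - c) in
  dot ('D_v L z) ('D_w L z) = (v *m (4 *: (B *m g z *m B^T)) *m w^T) 0 0.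
Proof.
move=> Uz A B L.
have DL t : 'D_t L z = t *m (2 *: B) *m jacobian y z.
  have dnz : derivable n z t by apply: diff_derivable; exact: dn.
  have dyz : derivable y z t by apply: diff_derivable; exact: dy.
  have dc : derivable (cst c : 'rV[R]_2 -> 'rV[R]_4) z t
    by exact: derivable_cst.
  rewrite (deriveD (derivableZ dnz) (derivableZ (derivableB dyz dc))).
  rewrite (deriveZ _ dnz) (deriveZ _ (derivableB dyz dc)) (deriveB dyz dc).
  rewrite derive_cst subr0 (derive_normal t Uz) (deriveEjacobian t (dy Uz)).
  rewrite -/A /B scalerN scaleNr opprK scalerDr mulmxDr mulmxDl.
  rewrite -!scalemxAr -!scalemxAl scalerA; congr (_ + _).
  by rewrite mul_mx_scalar -scalemxAl scalerA.
rewrite !DL (dot_tangent v w _ _ Uz) linearZ /=.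
congr ((v *m _ *m w^T) 0 0); rewrite -scalemxAr -!scalemxAl scalerA.
by congr (_ *: _); ring.
Qed.

Lemma derive_wedge (f k : 'rV[R]_2 -> 'rV[R]_4) z v :
  differentiable f z -> differentiable k z ->
  'D_v (fun u => wedge (f u) (k u)) z =
  wedge ('D_v f z) (k z) + wedge (f z) ('D_v k z).
Proof.
move=> df dk.
have dfT := differentiable_trmx df; have dkT := differentiable_trmx dk.
have d1 : derivable (fun u => (f u)^T *m k u) z v.
  by apply: diff_derivable; exact: differentiable_mulmx.
have d2 : derivable (fun u => (k u)^T *m f u) z v.
  by apply: diff_derivable; exact: differentiable_mulmx.
rewrite (deriveB d1 d2) (derive_mulmx v dfT dk) (derive_mulmx v dkT df).
rewrite (derive_trmx v df) (derive_trmx v dk) /wedge.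
by rewrite [X in _ - X]addrC opprD addrACA.
Qed.

(** By the Leibniz rule and [dot2_wedge_variation] the variations of [n] and of [e4] contribute
    separately; the latter is [r^-1] times that of [y], whence the term in [s]. *)
Lemma gauss_map_pullback z v w : U z ->
  let A := h z *m invmx (g z) in let G u := wedge (n u) (e4 u) in
  dot2 ('D_v G z) ('D_w G z) =
  (v *m (A *m g z *m A^T + s *: g z) *m w^T) 0 0.
Proof.
move=> Uz A G.
have de4 : differentiable e4 z.
  by apply: differentiableZ; exact: differentiable_sphere_position.
have De4 t : 'D_t e4 z = r^-1 *: 'D_t y z.
  have dyz : derivable y z t by apply: diff_derivable; exact: dy.
  have dc : derivable (cst c : 'rV[R]_2 -> 'rV[R]_4) z t
    by exact: derivable_cst.
  rewrite (deriveZ _ (derivableB dyz dc)) (deriveB dyz dc) derive_cst.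
  by rewrite subr0.
have Dnn t : dot ('D_t n z) (n z) = 0.
  have := etrans (esym (derive_dot t (dn Uz) (dn Uz)))
    (derive_constant_on t oU Uz nn).
  by rewrite [X in _ + X]dotC => /eqP; rewrite -mulr2n mulrn_eq0 /= => /eqP.
have Dyn t : dot ('D_t y z) (n z) = 0.
  rewrite (deriveEjacobian t (dy Uz)) dotE -mulmxA (_ : _ *m (n z)^T = 0).
    by rewrite mulmx0 mxE.
  apply/mulmx_row_tr_eq0 => k; rewrite (row_jacobian _ (dy Uz)); exact: yn.
have Dne t : dot ('D_t n z) (e4 z) = 0.
  have := etrans (esym (derive_dot_position t Uz (dn Uz)))
    (derive_constant_on t oU Uz nE).
  by rewrite (etrans (dotC _ _) (Dyn t)) addr0 dotZr => ->; rewrite mulr0.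
have ne : dot (n z) (e4 z) = 0 by rewrite dotZr (nE Uz) mulr0.
rewrite /G (derive_wedge v (dn Uz) de4) (derive_wedge w (dn Uz) de4) !De4.
have Dyn' : dot (r^-1 *: 'D_v y z) (n z) = 0 by rewrite dotZl Dyn mulr0.
rewrite (dot2_wedge_variation _ (nn Uz) (dot_e4 Uz) ne (Dnn v) (Dnn w)
  (Dne v) Dyn').
rewrite dotZl dotZr !(derive_normal _ Uz)
  dotNl dotNr opprK (dot_tangent _ _ _ _ Uz).
have -> : dot ('D_v y z) ('D_w y z) = (v *m g z *m w^T) 0 0.
  rewrite !(deriveEjacobian _ (dy Uz)).
  have := dot_tangent v w 1%:M 1%:M Uz.
  by rewrite trmx1 !mulmx1 mul1mx.
rewrite -/A mulmxDr mulmxDl -scalemxAr -scalemxAl [RHS]mxE [X in _ = _ + X]mxE.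
by rewrite mulrA -expr2 exprVn.
Qed.

(* The equality of the mixed second derivatives of [n] is the Codazzi
   equation, which here says that [D_i b D_j y = D_j b D_i y]. *)
Lemma umbilic_factor_derive0 (b : 'rV[R]_2 -> R) z v : U z ->
  (forall u, U u -> differentiable b u) ->
  (forall u i, U u -> partial i n u = - b u *: partial i y u) ->
  'D_v b z = 0.
Proof.
move=> Uz db nb.
have Un : nbhs z U by exact: open_nbhs_nbhs.
have dby i : differentiable (fun u => - b u *: partial i y u) z.
  apply: differentiable_scale; last exact: ddy.
  by apply: differentiableN; exact: db.
have neq i : \forall u \near z, - b u *: partial i y u = partial i n u.
  by apply: filterS Un => u Uu; rewrite nb.
(* Only first derivatives of [n] are given; its partials are differentiable because near [z] they
   equal products of differentiable maps. *)
have dni i : differentiable (partial i n) z.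
  exact: near_eq_differentiable (neq i) (dby i).
have D2n i j : partial i (partial j n) z =
    - 'D_(delta_mx 0 i) b z *: partial j y z - b z *: partial i (partial j y) z.
  transitivity ('D_(delta_mx 0 i) (fun u => - b u *: partial j y u) z).
    by apply/esym; exact: near_eq_derive (neq j).
  have dNb : differentiable (fun u => - b u) z.
    by apply: differentiableN; exact: db.
  rewrite (derive_scale _ dNb (ddy j Uz)) scaleNr; congr (_ *: _ + _).
  by apply: deriveN; apply: diff_derivable; exact: db.
have nC : partial 0 (partial 1 n) z = partial 1 (partial 0 n) z.
  apply: derive_comm_mx; [|exact: dni|exact: dni].
  by apply: filterS Un => u; exact: dn.
have codazzi : - 'D_(delta_mx 0 0) b z *: partial 1 y z =
    - 'D_(delta_mx 0 1) b z *: partial 0 y z.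
  have := etrans (etrans (esym (D2n 0 1)) nC) (D2n 1 0).
  have := f_equal (fun w => b z *: w) (partial_comm 0 1 Uz).
  move: (partial 0 (partial 1 y) z) (partial 1 (partial 0 y) z) => p q pq.
  by rewrite pq => /addIr.
(* The gradient of [b] turned by a right angle: [codazzi] says that the derivative of [y] along [t]
   is 0, so injectivity kills both partial derivatives of [b] at once. *)
pose t : 'rV[R]_2 := \row_j (if j == 0 then 'D_(delta_mx 0 1) b z
  else - 'D_(delta_mx 0 0) b z).
have t0 : t = 0.
  apply: (y_inj Uz); rewrite !(deriveEjacobian _ (dy Uz)) mul0mx.
  rewrite mulmx_sum_row big_ord_recl big_ord1 !(row_jacobian _ (dy Uz)) !mxE /=.
  rewrite (_ : lift 0 0 = 1 :> 'I_2); last exact: val_inj.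
  by rewrite -/(partial 0 y z) -/(partial 1 y z) codazzi scaleNr subrr.
have b1 : 'D_(delta_mx 0 1) b z = 0.
  by have := congr1 (fun w : 'rV[R]_2 => w 0 0) t0; rewrite !mxE.
have b0 : 'D_(delta_mx 0 0) b z = 0.
  have := congr1 (fun w : 'rV[R]_2 => w 0 1) t0; rewrite !mxE /= => /eqP.
  by rewrite oppr_eq0 => /eqP.
have [l lE] : exists l : {linear 'rV[R]_2 -> R}, forall t, 'D_t b z = l t.
  by exists ('d b z) => ?; exact: deriveE (db z Uz).
have vE : v = v 0 0 *: delta_mx 0 0 + v 0 1 *: delta_mx 0 1.
  by apply/rowP => k; rewrite !mxE; case: k => [[|[|//]] Hk] /=;
    rewrite ?mulr1 ?mulr0 ?addr0 ?add0r; congr (v 0 _); exact: val_inj.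
rewrite !lE in b0 b1; rewrite lE vE linearD !linearZ /= b0 b1.
by rewrite !scaler0 addr0.
Qed.

End ImmersionInSphere.

(** * Self-adjoint 2 x 2 matrices *)

Lemma bilinear_form_inj (R : realType) n (P Q : 'M[R]_n) :
  (forall v w : 'rV[R]_n, (v *m P *m w^T) 0 0 = (v *m Q *m w^T) 0 0) -> P = Q.
Proof.
move=> H; apply/matrixP => i j.
have := H (delta_mx 0 i) (delta_mx 0 j).
by rewrite -!rowE trmx_delta -!colE !mxE.
Qed.

Lemma cayley_hamilton_trace0 (R : realType) (A : 'M[R]_2) : \tr A = 0 ->
  A *m A = (- \det A)%:M.
Proof.
rewrite /mxtrace big_ord_recl big_ord1 (_ : lift 0 0 = 1 :> 'I_2);
  last exact: val_inj.
move=> tr0; have A11 : A 1 1 = - A 0 0 by lra.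
by apply: mxE2; rewrite mulmx2E det_mx2 !mxE /= A11; ring.
Qed.

Section SelfAdjoint2.
Variables (R : realType) (A g : 'M[R]_2).
Hypothesis g_posdef : forall v : 'rV[R]_2, v != 0 -> 0 < (v *m g *m v^T) 0 0.
Hypothesis g_sym : g^T = g.
Hypothesis A_adj : (A *m g)^T = A *m g.

Let quad (p q : R) : 'rV[R]_2 := \row_j (if j == 0 then p else q).

Let quadE p q : (quad p q *m g *m (quad p q)^T) 0 0 =
  p ^+ 2 * g 0 0 + 2 * p * q * g 0 1 + q ^+ 2 * g 1 1.
Proof.
have g10 : g 1 0 = g 0 1 by rewrite -[in LHS]g_sym mxE.
by rewrite !mulmx2E !mxE /= g10; ring.
Qed.

Let quad_eq0 p q : quad p q = 0 -> p = 0 /\ q = 0.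
Proof. by move=> /rowP H; have := H 0; have := H 1; rewrite !mxE. Qed.

Let A_adjE : A 1 0 * g 0 0 = (A 0 0 - A 1 1) * g 0 1 + A 0 1 * g 1 1.
Proof.
have g10 : g 1 0 = g 0 1 by rewrite -[in LHS]g_sym mxE.
have := congr1 (fun B : 'M[R]_2 => B 0 1) A_adj.
rewrite mxE !mulmx2E g10 => E.
by move: E => /eqP; rewrite -subr_eq0 => /eqP E; apply/eqP; rewrite -subr_eq0;
  apply/eqP; rewrite -[RHS]E; ring.
Qed.

Let g00 : 0 < g 0 0.
Proof.
have v0 : quad 1 0 != 0 by apply/eqP => /quad_eq0[/eqP]; rewrite oner_eq0.
have := g_posdef v0; rewrite quadE.
by rewrite expr1n mul1r mulr0 mul0r expr0n /= mul0r !addr0.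
Qed.

(** By [A_adjE], the discriminant times [g 0 0] is the value of the form [g] at the vector with
    components [A 0 0 - A 1 1] and [2 * A 0 1]; positive definiteness makes that vector 0, and
    [A_adjE] then gives [A 1 0 = 0]. *)
Lemma self_adjoint_discr_eq0 :
  (A 0 0 - A 1 1) ^+ 2 + 4 * A 0 1 * A 1 0 = 0 -> A = (A 0 0)%:M.
Proof.
move=> D.
have : quad (A 0 0 - A 1 1) (2 * A 0 1) = 0.
  apply: contraTeq (isT) => /g_posdef; rewrite quadE.
  have -> : (A 0 0 - A 1 1) ^+ 2 * g 0 0 +
      2 * (A 0 0 - A 1 1) * (2 * A 0 1) * g 0 1 + (2 * A 0 1) ^+ 2 * g 1 1 =
      ((A 0 0 - A 1 1) ^+ 2 + 4 * A 0 1 * A 1 0) * g 0 0.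
    rewrite [RHS]mulrDl -[4 * _ * _ * _]mulrA A_adjE; ring.
  by rewrite D mul0r ltxx.
move=> /quad_eq0[ad b]; have {}b : A 0 1 = 0 by lra.
have c : A 1 0 = 0.
  have := A_adjE; rewrite ad b !mul0r addr0 => /eqP.
  by rewrite mulf_eq0 (gt_eqF g00) orbF => /eqP.
apply: mxE2; rewrite !mxE /= ?b ?c //.
by apply/esym/eqP; rewrite -subr_eq0 ad.
Qed.

(** The form [g] takes the value [- \det A * g 0 0] at the first row of [A]. *)
Lemma self_adjoint_trace0_det_le0 : \tr A = 0 -> \det A <= 0.
Proof.
rewrite /mxtrace big_ord_recl big_ord1 (_ : lift 0 0 = 1 :> 'I_2);
  last exact: val_inj.
move=> tr0; have A11 : A 1 1 = - A 0 0 by apply/eqP;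
  rewrite -addr_eq0 addrC tr0.
rewrite det_mx2 A11 mulrN.
have : 0 <= (quad (A 0 0) (A 0 1) *m g *m (quad (A 0 0) (A 0 1))^T) 0 0.
  by have [->|/g_posdef/ltW//] := eqVneq (quad (A 0 0) (A 0 1)) 0;
    rewrite !mul0mx mxE.
rewrite quadE.
have -> : A 0 0 ^+ 2 * g 0 0 + 2 * A 0 0 * A 0 1 * g 0 1 + A 0 1 ^+ 2 * g 1 1 =
    (A 0 0 * A 0 0 + A 0 1 * A 1 0) * g 0 0.
  by rewrite [RHS]mulrDl -[A 0 1 * _ * _]mulrA A_adjE A11; ring.
by rewrite pmulr_lge0// => ?; lra.
Qed.

(** Here [f] stands for the square of the conformal factor. Once [g] is cancelled, the hypothesis is
    a quadratic equation for [A]. *)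
Lemma conformal_shape_scalar (H s f : R) : g \in unitmx -> s != 0 -> H != 0 ->
  \tr A = 2 * H ->
  let B := H *: A + s%:M in
  4 *: (B *m g *m B^T) = f *: (A *m g *m A^T + s *: g) -> A = (A 0 0)%:M.
Proof.
move=> gU s0 H0 trA B.
have gA : g *m A^T = A *m g by rewrite -[RHS]A_adj trmx_mul g_sym.
have gB : g *m B^T = B *m g.
  rewrite /B linearD /= linearZ /= tr_scalar_mx mulmxDr mulmxDl -scalemxAr gA.
  by rewrite -scalemxAl scalar_mxC.
rewrite -!mulmxA gA gB !mulmxA => E.
have {}E : 4 *: (B *m B) = f *: (A *m A + s%:M).
  apply: (can_inj (mulmxK gU)); rewrite -!scalemxAl E; congr (_ *: _).
  by rewrite mulmxDl mul_scalar_mx.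
move: trA; rewrite /mxtrace big_ord_recl big_ord1 (_ : lift 0 0 = 1 :> 'I_2);
  last exact: val_inj.
move=> trA; apply: self_adjoint_discr_eq0.
have := congr1 (fun X : 'M[R]_2 => X 0 0) E.
have := congr1 (fun X : 'M[R]_2 => X 0 1) E.
have := congr1 (fun X : 'M[R]_2 => X 1 0) E.
have := congr1 (fun X : 'M[R]_2 => X 1 1) E.
rewrite /B !(mulmx2E, mxE) /=.
have -> : A 1 1 = 2 * H - A 0 0 by lra.
move: (A 0 0) (A 0 1) (A 1 0) => a b k; rewrite !(mulr0n, mulr1n).
move=> E11 E10 E01 E00.
(* Up to a scalar matrix [A *m A] is [2 * H] times [A], so the off-diagonal entries and the
   difference of the diagonal ones satisfy the same linear equation. *)
have Hf : H * (4 * (H ^+ 2 + s) - f) * b = 0 by lra.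
have Hf' : H * (4 * (H ^+ 2 + s) - f) * k = 0 by lra.
have Hf'' : H * (4 * (H ^+ 2 + s) - f) * (a - H) = 0 by lra.
have [f0|f0] := eqVneq (4 * (H ^+ 2 + s) - f) 0; last first.
  have c0 : H * (4 * (H ^+ 2 + s) - f) != 0 by rewrite mulf_neq0.
  move: Hf Hf' Hf''; move/eqP; rewrite mulf_eq0 (negPf c0) => /eqP ->.
  move/eqP; rewrite mulf_eq0 (negPf c0) => /eqP ->.
  move/eqP; rewrite mulf_eq0 (negPf c0) /= subr_eq0 => /eqP ->.
  by ring.
have fE : f = 4 * (H ^+ 2 + s) by lra.
subst f.
(* For this value of [f] the equation reduces to [s] times the square of [A - H%:M] being 0, and its
   diagonal entry is a multiple of the discriminant. *)
have : s * ((a - (2 * H - a)) ^+ 2 + 4 * b * k) = 0 by lra.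
by move/eqP; rewrite mulf_eq0 (negPf s0) => /eqP.
Qed.

End SelfAdjoint2.

(** * Surfaces in a hypersphere *)

(* [coord] and [coord_continuous] are otherwise those of MathComp. *)
Local Notation coord := Defs.coord.

Lemma connected_locally_constant (T : topologicalType) (V : Type) (f : T -> V)
    (p0 p : T) : connected [set: T] ->
  (forall q, \forall q' \near q, f q' = f q) -> f p = f p0.
Proof.
move=> Tc lc; have : [set q | f q = f p0] = [set: T].
  apply: Tc.
  - by exists p0.
  - exists [set q | f q = f p0]; last by rewrite setTI.
    by rewrite openE => q /= qp0; apply: filterS (lc q) => q' /= ->.
  - exists [set q | f q = f p0]; last by rewrite setTI.
    by rewrite -openC openE => q /= qp0; apply: filterS (lc q) => q' /= ->.
by move=> /seteqP[_ /(_ p)]; exact.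
Qed.

(** * Charts and changes of chart *)

Section Charts.
Variables (R : realType) (M : orientedSurface R).
Implicit Types (a b : chart M) (p : M).

Definition chart_image a : set 'rV[R]_2 := coord a @` dom a.

Lemma chart_image_open a : open (chart_image a).
Proof. exact: image_open. Qed.

Lemma chart_image_coord a p : dom a p -> chart_image a (coord a p).
Proof. by move=> ap; exists p. Qed.

Lemma chart_imageP a u :
  chart_image a u -> dom a (param a u) /\ coord a (param a u) = u.
Proof. by case=> p ap <-; rewrite coordK. Qed.

(** The passage goes from [b] to [a]: a tangent vector with components [v] in [b] has components
    [v *m transition_jacobian a b p] in [a]. *)
Definition transition_jacobian a b p : 'M[R]_2 :=
  jacobian (coord a \o param b) (coord b p).

Lemma transition_jacobian_det a b p : dom a p -> dom b p ->
  0 < \det (transition_jacobian a b p).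
Proof. by move=> ap bp; exact: transition_oriented. Qed.

Lemma transition_jacobian_unit a b p : dom a p -> dom b p ->
  transition_jacobian a b p \in unitmx.
Proof.
by move=> ap bp; rewrite unitmxE unitfE gt_eqF// transition_jacobian_det.
Qed.

Lemma dmap_transition (V : normedModType R) (f : M -> V) a b p v :
  dom a p -> dom b p -> differentiable (f \o param a) (coord a p) ->
  dmap f b p v = dmap f a p (v *m transition_jacobian a b p).
Proof.
move=> ap bp df; have ub := chart_image_coord bp.
have pb : param b (coord b p) = p by exact: coordK.
have dt : differentiable (coord a \o param b) (coord b p).
  have := @transition_smooth _ M b a 1%N; case => + _; apply.
  by exists p.
have near_a : \forall u \near coord b p, dom a (param b u).
  apply: (param_continuous ub); rewrite pb; apply: open_nbhs_nbhs; split => //.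
  exact: dom_open.
rewrite /dmap; transitivity
    ('D_v ((f \o param a) \o (coord a \o param b)) (coord b p)).
  apply: near_eq_derive; apply: filterS near_a => u au /=.
  by rewrite (coordK au).
have dfp : differentiable (f \o param a) ((coord a \o param b) (coord b p)).
  by rewrite /= pb.
by rewrite (derive_comp v dt dfp) (deriveEjacobian _ dt) /= pb.
Qed.

Lemma derive0_locally_constant (f : M -> R) a p : dom a p ->
  (forall u, chart_image a u -> differentiable (f \o param a) u) ->
  (forall u v, chart_image a u -> 'D_v (f \o param a) u = 0) ->
  \forall q \near p, f q = f p.
Proof.
move=> ap df Df.
have /derive0_near_constant : \forall u \near coord a p, forall v,
    derivable (f \o param a) u v /\ 'D_v (f \o param a) u = 0.
  apply: filterS (open_nbhs_nbhs (conj (@chart_image_open a)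
    (chart_image_coord ap))).
  by move=> u Uu v; split; [apply: diff_derivable; exact: df|exact: Df].
have cc : {for p, continuous (coord a)} by exact: Defs.coord_continuous.
move=> /cc; rewrite /= (coordK ap).
have oa : open (dom a) := @dom_open _ _ a.
have := open_nbhs_nbhs (conj oa ap); apply: filterS2 => q aq.
by rewrite /= (coordK aq).
Qed.

End Charts.

(** * The unit normal and the shape operator on the surface *)

Section SurfaceInHypersphere.
Variables (R : realType) (M : orientedSurface R).
Variables (c : 'rV[R]_4) (r : R) (x : M -> 'rV[R]_4).
Hypotheses (r_gt0 : 0 < r) (x_immersion : immersion x).
Hypothesis x_sphere : in_hypersphere c r x.
Implicit Types (a b : chart M) (p : M).

Let y a := x \o param a.
Let N := sphere_normal c r x.
Let E p := r^-1 *: (x p - c).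
Let Y a p : 'M[R]_(2, 4) := jacobian (y a) (coord a p).
Let n a := N \o param a.

Lemma position_differentiable a u : chart_image a u -> differentiable (y a) u.
Proof. by case: x_immersion => /(_ a 1%N)[+ _] _; apply. Qed.

Lemma partial_position_differentiable a u i :
  chart_image a u -> differentiable (partial i (y a)) u.
Proof. by case: x_immersion => /(_ a 2%N)[_ /(_ (delta_mx 0 i))[+ _]] _;
  apply. Qed.

Lemma position_injective a u :
  chart_image a u -> injective (fun v => 'D_v (y a) u).
Proof. by case=> p ap <-; exact: x_immersion.2. Qed.

Lemma position_sphere a u : dot (y a u - c) (y a u - c) = r ^+ 2.
Proof. exact: x_sphere. Qed.

Lemma dmapE a p v : dom a p -> dmap x a p v = v *m Y a p.
Proof.
by move=> ap; apply: deriveEjacobian; apply: position_differentiable; exists p.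
Qed.

Lemma jacobian_transition a b p : dom a p -> dom b p ->
  Y b p = transition_jacobian a b p *m Y a p.
Proof.
move=> ap bp; apply/row_matrixP => i;
  rewrite !rowE mulmxA -(dmapE _ bp) -(dmapE _ ap).
by apply: (dmap_transition _ ap bp); apply: position_differentiable; exists p.
Qed.

Lemma gram_jacobian_unit a p : dom a p -> \det (Y a p *m (Y a p)^T) != 0.
Proof.
move=> ap; have ua := chart_image_coord ap.
rewrite -(metricE (@position_differentiable a) ua).
by rewrite -unitfE -unitmxE (metric_unit (@position_differentiable a)
  (@position_injective a) ua).
Qed.

Lemma position_jacobian_normal a p : dom a p -> Y a p *m (E p)^T = 0.
Proof.
move=> ap; have ua := chart_image_coord ap; apply/mulmx_row_tr_eq0 => i.
rewrite row_jacobian; last exact: position_differentiable.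
rewrite dotZr (_ : x p = y a (coord a p)); last by rewrite /y /= coordK.
rewrite (position_normal (@chart_image_open _ _ a) (@position_differentiable a)
  (fun u _ => position_sphere a u) _ ua).
by rewrite mulr0.
Qed.

Lemma dot_unit_position p : dot (E p) (E p) = 1.
Proof. by rewrite dotZl dotZr x_sphere; field; exact: lt0r_neq0. Qed.

Lemma oriented_normal_frameE p e3 e4 : oriented_normal_frame x p e3 e4 <->
  [/\ dot e3 e3 = 1, dot e4 e4 = 1, dot e3 e4 = 0 &
    forall a, dom a p -> [/\ Y a p *m e3^T = 0, Y a p *m e4^T = 0 &
      0 < \det (col_mx (Y a p) (rows2 e3 e4) : 'M[R]_4)]].
Proof.
have rowsE a : dom a p ->
    (\matrix_(i < 4) [:: dmap x a p (delta_mx 0 0); dmap x a p (delta_mx 0 1);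
      e3; e4]`_i) =
    (col_mx (Y a p) (rows2 e3 e4) : 'M[R]_4).
  move=> ap; rewrite (dmapE _ ap) (dmapE _ ap) -!rowE [in RHS](rows2E (Y a p)).
  apply/matrixP => i j; rewrite [LHS]mxE [RHS]mxE.
  case: splitP => k ik; rewrite mxE ik.
    by case: k ik => [[|[|//]] Hk].
  by case: k ik => [[|[|//]] Hk].
have normalE a e : dom a p ->
    (forall i : 'I_2, dot (dmap x a p (delta_mx 0 i)) e = 0)
      <-> Y a p *m e^T = 0.
  move=> ap; rewrite mulmx_row_tr_eq0.
  by split=> H i; have := H i; rewrite dmapE// rowE.
split=> -[e33 e44 e34 H]; split=> // a ap.
  by have [/(normalE _ _ ap) H3 /(normalE _ _ ap) H4] := H a ap; rewrite rowsE.
have [H3 H4 Hd] := H a ap; split;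
  [exact/(normalE _ _ ap)|exact/(normalE _ _ ap)|].
by rewrite rowsE.
Qed.

(** The default value of [xget] does not occur: the vector product formed in one chart is a positive
    normal in every chart, because transition Jacobians have positive determinant. *)
Lemma sphere_normalP p : oriented_normal_frame x p (N p) (E p).
Proof.
rewrite /N /sphere_normal; case: xgetP => [w _ //|none]; exfalso.
have [a ap] := chart_cover p.
have Ya := gram_jacobian_unit ap; have YE := position_jacobian_normal ap.
have [ee eE Ye ed] := unit_normalP Ya YE (dot_unit_position p).
apply: (none (unit_normal (Y a p) (E p))) => /=; apply/oriented_normal_frameE.
split; [exact: ee|exact: dot_unit_position|exact: eE|move=> b bp].
have Yt := jacobian_transition ap bp.
split; [by rewrite Yt -mulmxA Ye mulmx0|by rewrite Yt -mulmxA YE mulmx0|].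
rewrite Yt -[rows2 _ _]mul1mx det_col_mx_mul det1 mulr1.
exact: mulr_gt0 (transition_jacobian_det ap bp) ed.
Qed.

Lemma sphere_normal_gram p :
  rows2 (N p) (E p) *m (rows2 (N p) (E p))^T = 1%:M.
Proof. by have /oriented_normal_frameE[] := sphere_normalP p => *;
  exact: rows2_gram1. Qed.

Lemma sphere_normal_frame_orth a p : dom a p ->
  Y a p *m (rows2 (N p) (E p))^T = 0.
Proof.
by have /oriented_normal_frameE[_ _ _ H] := sphere_normalP p => /H[? ? _];
  exact: mul_rows2_tr_eq0.
Qed.

(** Uniqueness turns the pointwise choice into an explicit formula, from which
    [normal_differentiable] follows. *)
Lemma sphere_normal_unit_normal a p : dom a p ->
  N p = unit_normal (Y a p) (E p).
Proof.
move=> ap; have Ya := gram_jacobian_unit ap.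
have [ee eE Ye ed] := unit_normalP Ya (position_jacobian_normal ap)
  (dot_unit_position p).
have /oriented_normal_frameE[_ _ _ /(_ a ap)[_ _ dN]] := sphere_normalP p.
apply: (unit_normal_unique Ya _ _ (sphere_normal_frame_orth ap)
  (sphere_normal_gram p) ed dN).
  by apply: mul_rows2_tr_eq0 => //; exact: position_jacobian_normal.
by apply: rows2_gram1 => //; exact: dot_unit_position.
Qed.

Lemma gauss_mapE p : gauss_map x p = wedge (N p) (E p).
Proof.
rewrite /gauss_map; case: xgetP => [w -> [e3 [e4 [fr ->]]]|none].
  have [a ap] := chart_cover p.
  move: fr => /oriented_normal_frameE[e33 e44 e34 /(_ a ap)[Y3 Y4 d34]].
  have /oriented_normal_frameE[_ _ _ /(_ a ap)[_ _ dN]] := sphere_normalP p.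
  apply: (wedge_normal_frame (gram_jacobian_unit ap)
    (sphere_normal_frame_orth ap) (sphere_normal_gram p) _ _ dN d34).
    exact: mul_rows2_tr_eq0.
  exact: rows2_gram1.
exfalso; apply: (none (wedge (N p) (E p))).
by exists (N p), (E p); split => //; exact: sphere_normalP.
Qed.

Lemma normal_differentiable a u : chart_image a u -> differentiable (n a) u.
Proof.
move=> Uu; have oU := @chart_image_open _ _ a.
apply: (@near_eq_differentiable _ _ _
    (fun w => unit_normal (jacobian (y a) w) (r^-1 *: (y a w - c)))).
  apply: filterS (open_nbhs_nbhs (conj oU Uu)) => w /chart_imageP[dw cw].
  by rewrite /n /= (sphere_normal_unit_normal dw) /Y cw.
have [du cu] := chart_imageP Uu.
apply: differentiable_unit_normal.
- apply: differentiable_jacobian_of_rows.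
    apply: filterS (open_nbhs_nbhs (conj oU Uu)) => w;
      exact: position_differentiable.
  by move=> i; exact: partial_position_differentiable.
- apply: differentiableZ; apply: differentiableB;
  last exact: differentiable_cst.
  exact: position_differentiable.
- have := cross_neq0 (gram_jacobian_unit du) (position_jacobian_normal du)
    (dot_unit_position _).
  by rewrite /Y cu.
Qed.

Lemma normal_unit a u : dot (n a u) (n a u) = 1.
Proof. by have [] := sphere_normalP (param a u). Qed.

Lemma normal_position a u : dot (n a u) (y a u - c) = 0.
Proof.
have [_ _ + _] := sphere_normalP (param a u).
rewrite dotZr => /eqP; rewrite mulf_eq0 invr_eq0 (gt_eqF r_gt0) /=.
by move/eqP.
Qed.

Lemma partial_position_normal a u i : chart_image a u ->
  dot (partial i (y a) u) (n a u) = 0.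
Proof.
move=> /chart_imageP[du cu].
have [_ _ _ /(_ _ du)[/(_ i) + _ _]] := sphere_normalP (param a u).
by rewrite /dmap cu.
Qed.

Lemma shape_operatorE a u : chart_image a u ->
  shape_operator c r x a (param a u) =
  (\matrix_(i, j) dot (partial i (partial j (y a)) u) (n a u)) *m
    invmx (metric (y a) u).
Proof. by move=> /chart_imageP[_ cu]; rewrite /shape_operator /second_form cu.
Qed.

Local Notation A := (shape_operator c r x).
Local Notation alpha := (mean_curvature c r x).

Lemma dmap_normal a p v : dom a p -> dmap N a p v = - (v *m A a p *m Y a p).
Proof.
move=> ap; have ua := chart_image_coord ap.
rewrite -[p in A a p](coordK ap) (shape_operatorE ua).
exact: (derive_normal (@chart_image_open _ _ a)
  r_gt0 (@position_differentiable a)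
  (@partial_position_differentiable a) (@position_injective a)
  (fun u _ => position_sphere a u) (@normal_differentiable a)
  (fun u _ => normal_unit a u) (fun u _ => normal_position a u)
  (@partial_position_normal a) v ua).
Qed.

(** Both products describe the differential of the normal, and the injective differential of [x] can
    be cancelled. *)
Lemma shape_operator_transition a b p : dom a p -> dom b p ->
  let T := transition_jacobian a b p in A b p *m T = T *m A a p.
Proof.
move=> ap bp T; apply/row_matrixP => i; rewrite !rowE.
move: (delta_mx 0 i) => v.
have : dmap N b p v = dmap N a p (v *m T).
  by apply: (dmap_transition _ ap bp); apply: normal_differentiable; exists p.
rewrite (dmap_normal _ bp) (dmap_normal _ ap) (jacobian_transition ap bp) -/T.
move=> /oppr_inj; move: (A a p) (A b p) => Aa Ab E1.
apply: (x_immersion.2 _ _ ap).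
by rewrite !(dmapE _ ap) !mulmxA -E1 mulmxA.
Qed.

Lemma shape_operator_conj a b p : dom a p -> dom b p ->
  let T := transition_jacobian a b p in A b p = T *m A a p *m invmx T.
Proof.
move=> ap bp T; have TU := transition_jacobian_unit ap bp.
by rewrite -(shape_operator_transition ap bp) mulmxK.
Qed.

(** The mean curvature is defined through [chart_at p]; invariance of the trace under conjugation
    frees it from that chart. *)
Lemma tr_shape_operator a p : dom a p -> \tr (A a p) = 2 * alpha p.
Proof.
move=> ap; rewrite /mean_curvature mulrA mulfV ?pnatr_eq0// mul1r.
have bp : dom (chart_at p) p := svalP (cid (chart_cover p)).
rewrite (shape_operator_conj bp ap) mxtrace_mulC mulmxA mulVmx ?mul1mx//.
exact: transition_jacobian_unit.
Qed.

Lemma det_shape_operator a b p : dom a p -> dom b p ->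
  \det (A b p) = \det (A a p).
Proof.
move=> ap bp; have := congr1 determinant (shape_operator_transition ap bp).
have : \det (transition_jacobian a b p) != 0
  by rewrite gt_eqF// transition_jacobian_det.
move: (A a p) (A b p) (transition_jacobian a b p) => Aa Ab T T0.
by rewrite !det_mulmx mulrC => /(mulfI T0).
Qed.

(** * Conformality of the LG-transformation *)

Let g a p := metric (y a) (coord a p).
Let s := r ^- 2.

Lemma metric_chart_posdef a p (v : 'rV[R]_2) : dom a p -> v != 0 ->
  0 < (v *m g a p *m v^T) 0 0.
Proof.
move=> ap; exact: (metric_posdef (@position_differentiable a)
  (@position_injective a) (chart_image_coord ap)).
Qed.

Lemma metric_chart_unit a p : dom a p -> g a p \in unitmx.
Proof.
move=> ap; exact: (metric_unit (@position_differentiable a)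
  (@position_injective a) (chart_image_coord ap)).
Qed.

Lemma shape_operator_adjoint a p : dom a p ->
  (A a p *m g a p)^T = A a p *m g a p.
Proof.
move=> ap; have ua := chart_image_coord ap.
rewrite -[p in A a p](coordK ap) (shape_operatorE ua).
rewrite (mulmxKV (metric_chart_unit ap)).
exact: (second_form_sym _ (@chart_image_open _ _ a) (@position_differentiable a)
  (@partial_position_differentiable a) ua).
Qed.

Lemma gauss_map_conformal_form a p v w : dom a p ->
  dot2 (dmap (gauss_map x) a p v) (dmap (gauss_map x) a p w) =
  (v *m (A a p *m g a p *m (A a p)^T + s *: g a p) *m w^T) 0 0.
Proof.
move=> ap; have ua := chart_image_coord ap.
have GE : gauss_map x \o param a =
    (fun u => wedge (n a u) (r^-1 *: (y a u - c))).
  by apply/funext => u; exact: gauss_mapE.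
rewrite /dmap GE -[p in A a p](coordK ap) (shape_operatorE ua).
exact: (gauss_map_pullback (@chart_image_open _ _ a)
  r_gt0 (@position_differentiable a)
  (@partial_position_differentiable a) (@position_injective a)
  (fun u _ => position_sphere a u) (@normal_differentiable a)
  (fun u _ => normal_unit a u) (fun u _ => normal_position a u)
  (@partial_position_normal a) v w ua).
Qed.

(** The left side is computed in [chart_at p], whereas the right side mentions no chart and can be
    differentiated in any of them. *)
Lemma laplace_mapE p :
  laplace_map x p = - (2 * alpha p) *: N p + (2 * r ^- 2) *: (x p - c).
Proof.
have bp : dom (chart_at p) p := svalP (cid (chart_cover p)).
have ub := chart_image_coord bp; rewrite -(tr_shape_operator bp).
rewrite -[p in A _ p](coordK bp) (shape_operatorE ub).
rewrite /laplace_map (laplacian_position (n := n (chart_at p))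
  (@chart_image_open _ _ (chart_at p)) r_gt0
  (@position_differentiable (chart_at p))
  (@partial_position_differentiable (chart_at p))
    (@position_injective (chart_at p))
  (fun u _ => position_sphere (chart_at p) u)
  (fun u _ => normal_unit (chart_at p) u)
  (fun u _ => normal_position (chart_at p) u)
  (@partial_position_normal (chart_at p)) ub).
by rewrite /n /y /= (coordK bp).
Qed.

Lemma laplace_map_conformal_form (H : R) a p v w :
  (forall q, alpha q = H) -> dom a p ->
  let B := H *: A a p + s%:M in
  dot (dmap (laplace_map x) a p v) (dmap (laplace_map x) a p w) =
  (v *m (4 *: (B *m g a p *m B^T)) *m w^T) 0 0.
Proof.
move=> aH ap B; have ua := chart_image_coord ap.
have LE : laplace_map x \o param a =
    (fun u => - (2 * H) *: n a u + (2 * s) *: (y a u - c)).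
  by apply/funext => u; rewrite -(aH (param a u)); exact: laplace_mapE.
rewrite /B /dmap LE -[p in A a p](coordK ap) (shape_operatorE ua).
exact: (laplace_map_pullback (@chart_image_open _ _ a)
  r_gt0 (@position_differentiable a)
  (@partial_position_differentiable a) (@position_injective a)
  (fun u _ => position_sphere a u) (@normal_differentiable a)
  (fun u _ => normal_unit a u) (fun u _ => normal_position a u)
  (@partial_position_normal a) v w H ua).
Qed.

Lemma inv_sqr_radius_gt0 : 0 < s.
Proof. by rewrite /s invr_gt0 exprn_gt0. Qed.

(** The mean curvature is one number [H] for all points, so the case distinction on [H = 0] is
    global and the two kinds of points cannot mix. *)
Lemma conformal_LG_dichotomy :
  constant_mean_curvature c r x -> conformal_LG x ->
  totally_umbilical c r x \/ minimal_surface c r x.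
Proof.
move=> [H aH] [f _ fP]; have [H0|H0] := eqVneq H 0.
  by right => p; rewrite aH.
left=> a p ap; exists (A a p 0 0).
apply: (conformal_shape_scalar (fun v => @metric_chart_posdef a p v ap) _
  (shape_operator_adjoint ap) (H := H) (s := s) (f := f p ^+ 2)) => //.
- exact: metric_sym.
- exact: metric_chart_unit.
- by rewrite gt_eqF// inv_sqr_radius_gt0.
- by rewrite (tr_shape_operator ap) aH.
apply: bilinear_form_inj => v w.
rewrite -(laplace_map_conformal_form v w aH ap) (fP _ _ ap).
rewrite (gauss_map_conformal_form v w ap).
by rewrite -scalemxAr -scalemxAl [RHS]mxE.
Qed.

Lemma minimal_conformal_LG : minimal_surface c r x ->
  constant_mean_curvature c r x /\ conformal_LG x.
Proof.
move=> a0; split; first by exists 0.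
(* For mean curvature 0 the Laplace map induces [4 * s ^+ 2] times the metric, and by
   Cayley-Hamilton the Gauss map induces [K p] times it; hence the factor [2 * s / Num.sqrt (K p)]
   below. [K p] is positive because a trace-free self-adjoint [A] has determinant at most 0. *)
pose K p := s - \det (A (chart_at p) p).
have K0 p : 0 < K p.
  have bp : dom (chart_at p) p := svalP (cid (chart_cover p)).
  rewrite /K subr_gt0 (le_lt_trans _ inv_sqr_radius_gt0)//.
  apply: (self_adjoint_trace0_det_le0 (fun v => @metric_chart_posdef _ p v bp)
    (metric_sym _ _) (shape_operator_adjoint bp)).
  by rewrite (tr_shape_operator bp) a0 mulr0.
exists (fun p => 2 * s / Num.sqrt (K p)) => [p|a p ap v w].
  by rewrite divr_gt0 ?mulr_gt0 ?sqrtr_gt0// inv_sqr_radius_gt0.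
rewrite (laplace_map_conformal_form v w a0 ap)
  (gauss_map_conformal_form v w ap).
have KE : K p = s - \det (A a p).
  have bp : dom (chart_at p) p := svalP (cid (chart_cover p)).
  exact: (f_equal (fun t => s - t) (det_shape_operator ap bp)).
rewrite expr_div_n (sqr_sqrtr (ltW (K0 p))) scale0r add0r.
have gA : g a p *m (A a p)^T = A a p *m g a p.
  have gT : (g a p)^T = g a p by exact: metric_sym.
  by rewrite -[RHS](shape_operator_adjoint ap) [RHS]trmx_mul gT.
have -> : A a p *m g a p *m (A a p)^T + s *: g a p = K p *: g a p.
  rewrite -mulmxA gA mulmxA (cayley_hamilton_trace0 (A := A a p)).
    by rewrite mul_scalar_mx -scalerDl addrC KE.
  by rewrite (tr_shape_operator ap) a0 mulr0.
rewrite tr_scalar_mx mul_scalar_mx mul_mx_scalar !scalerA.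
rewrite -!scalemxAr -!scalemxAl [LHS]mxE [in RHS]mxE mulrA; congr (_ * _).
by field; rewrite gt_eqF.
Qed.

(** * Umbilical surfaces: constancy of the mean curvature and conformality *)

Hypothesis L_smooth : smooth_map (laplace_map x).

(** By [laplace_mapE] the normal part of the Laplace map is [- 2] times the mean curvature; pairing
    with the normal recovers it from maps already known to be differentiable. *)
Lemma mean_curvature_differentiable a u : chart_image a u ->
  differentiable (alpha \o param a) u.
Proof.
move=> Uu.
have -> : alpha \o param a = (fun w => - 2^-1 * dot
    ((laplace_map x \o param a) w - (2 * s) *: (y a w - c)) (n a w)).
  apply/funext => w; rewrite /= laplace_mapE addrK dotZl.
  by rewrite (normal_unit a w) mulr1 mulrNN mulrA mulVf ?mul1r// pnatr_eq0.
have dL : differentiable (laplace_map x \o param a) u.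
  by have [+ _] := L_smooth a 1%N; apply.
apply: differentiableZ; apply: differentiable_dot;
  last exact: normal_differentiable.
apply: differentiableB => //; apply: differentiableZ; apply: differentiableB.
  exact: position_differentiable.
exact: differentiable_cst.
Qed.

Lemma umbilical_shape_operator a p : totally_umbilical c r x -> dom a p ->
  A a p = (alpha p)%:M.
Proof.
move=> umb ap; have := tr_shape_operator ap; have [k ->] := umb a p ap.
have two0 : (2 : R) != 0 by rewrite pnatr_eq0.
by rewrite mxtrace_scalar -[k *+ 2]mulr_natl => /(mulfI two0) ->.
Qed.

Lemma umbilical_mean_curvature_locally_constant p :
  totally_umbilical c r x -> \forall q \near p, alpha q = alpha p.
Proof.
move=> umb; have [a ap] := chart_cover p; have ua := chart_image_coord ap.
have Un := open_nbhs_nbhs (conj (@chart_image_open _ _ a) ua).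
have nu u i : chart_image a u ->
    partial i (n a) u = - (alpha (param a u)) *: partial i (y a) u.
  move=> /chart_imageP[du cu].
  have := dmap_normal (delta_mx 0 i) du;
    rewrite (umbilical_shape_operator umb du).
  by rewrite mul_mx_scalar -scalemxAl -(dmapE _ du) /dmap cu scaleNr.
have D0 u v : chart_image a u -> 'D_v (alpha \o param a) u = 0.
  move=> Uu; exact: (umbilic_factor_derive0 (@chart_image_open _ _ a)
    (@position_differentiable a) (@partial_position_differentiable a)
    (@position_injective a) (@normal_differentiable a) v Uu
    (@mean_curvature_differentiable a) nu).
exact: (derive0_locally_constant ap (@mean_curvature_differentiable a) D0).
Qed.

Lemma umbilical_conformal_LG : connected [set: M] -> totally_umbilical c r x ->
  constant_mean_curvature c r x /\ conformal_LG x.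
Proof.
move=> Mc umb.
have [H aH] : constant_mean_curvature c r x.
  (* Connectedness does not exclude an empty surface, on which any constant will do; otherwise a
     base point supplies the constant. *)
  have [[p0 _]|M0] := pselect (exists p : M, True); last first.
    by exists 0 => p; exfalso; apply: M0; exists p.
  exists (alpha p0) => p.
  apply: (@connected_locally_constant _ _ alpha _ _ Mc) => q.
  exact: umbilical_mean_curvature_locally_constant.
split; first by exists H.
have s0 := inv_sqr_radius_gt0.
have Hs : 0 < H ^+ 2 + s by rewrite ltr_wpDl// sqr_ge0.
(* With [A] equal to [H] times the identity, the Laplace and Gauss maps induce
   [4 * (H ^+ 2 + s) ^+ 2] and [H ^+ 2 + s] times the metric; the factor is the square root of the
   quotient. *)
exists (fun=> 2 * Num.sqrt (H ^+ 2 + s)) => [_|a p ap v w].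
  by rewrite mulr_gt0// sqrtr_gt0.
rewrite (laplace_map_conformal_form v w aH ap)
  (gauss_map_conformal_form v w ap).
rewrite (umbilical_shape_operator umb ap) aH exprMn (sqr_sqrtr (ltW Hs)).
have -> : H *: (H%:M : 'M[R]_2) + s%:M = (H ^+ 2 + s)%:M.
  by rewrite scale_scalar_mx -expr2 -raddfD.
rewrite !tr_scalar_mx !mul_mx_scalar !mul_scalar_mx !scalerA -scalerDl.
rewrite -!scalemxAr -!scalemxAl !mxE mulrA; congr (_ * _).
by ring.
Qed.

End SurfaceInHypersphere.

Theorem theorem2p3 (R : realType) (M : orientedSurface R)
    (c : 'rV[R]_4) (r : R) (x : M -> 'rV[R]_4)
    (r_gt0 : 0 < r)
    (M_connected : connected [set: M])
    (x_immersion : immersion x)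
    (x_sphere : in_hypersphere c r x)
    (L_immersion : immersion (laplace_map x)) :
  constant_mean_curvature c r x /\ conformal_LG x <->
  totally_umbilical c r x \/ minimal_surface c r x.
Proof.
split=> [[]|[]]; first exact: conformal_LG_dichotomy.
  by apply: umbilical_conformal_LG; case: L_immersion.
exact: minimal_conformal_LG.
Qed.
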